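(* Let $(X,d)$ be a nonempty compact metric space and let $\ell:X\times X\times\mathbb R\times\mathbb R\to\mathbb R$, $(x,y,u,v)\mapsto \ell(x,y,u,v)$, be a continuous function that is $C^1$ with respect to the last two variables $(u,v)$ and such that: (1) there is a constant $\kappa_u>0$ such that $0\ge \partial_u\ell(x,y,u,v)\ge-\kappa_u$ for all $(x,y,u,v)$; (2) there is a constant $\kappa_v>0$ such that $0\ge \partial_v\ell(x,y,u,v)\ge-\kappa_v$ for all $(x,y,u,v)$; (3) $\int_{X\times X}\big(\partial_u\ell(z,x,0,0)+\partial_v\ell(z,x,0,0)\big)\,d\mu(z,x)<0$ for all Mather measures $\mu$ of $\ell_0:=\ell(\cdot,\cdot,0,0)$. Let $c_0$ be the critical constant of $\ell_0$, let $\lambda_0>0$ satisfy $\lambda_0\max(\kappa_u,\kappa_v)<1$, and for $\lambda\in(0,\lambda_0)$ let $S_\lambda\subset C^0(X,\mathbb R)$ be the set of fixed points of the associated implicit Lax-Oleinik operator $T_\lambda$. Then the family $(S_\lambda)_{\lambda\in(0,\lambda_0)}$ converges to a singleton as $\lambda\to0$, in the sense that there exists a function $u_0:X\to\mathbb R$ such that for any choice of $u_\lambda\in S_\lambda$ for $\lambda\in(0,\lambda_0)$, $u_\lambda\to u_0$ uniformly on $X$ as $\lambda\to0^+$.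
   Context: ''$C^1$ with respect to the last two variables'' means that the partial derivatives $\partial_u\ell,\partial_v\ell$ exist everywhere and are continuous on $X\times X\times\mathbb R\times\mathbb R$. Critical constant: for a continuous $\ell_0:X\times X\to\mathbb R$, there is a unique constant $c_0\in\mathbb R$ for which there exists a continuous $u:X\to\mathbb R$ with $u(x)=\min_{y\in X}\{u(y)+\ell_0(y,x)\}+c_0$ for all $x\in X$ (known theorem); $c_0$ is the critical constant of $\ell_0$. Mather measure: a Borel probability measure $\mu$ on $X\times X$ is closed if its two marginals on $X$ coincide. A Mather measure of $\ell_0$ is a closed Borel probability measure $\mu$ on $X\times X$ with $\int_{X\times X}\ell_0\,d\mu=-c_0$. Implicit Lax-Oleinik operator: for $0<\lambda<\lambda_0$ and $\varphi\in C^0(X,\mathbb R)$, $T_\lambda\varphi$ is the unique function in $C^0(X,\mathbb R)$ such that for all $x\in X$ $$T_\lambda\varphi(x)=\min_{z\in X}\big\{\varphi(z)+\ell\big(z,x,\lambda\varphi(z),\lambda T_\lambda\varphi(x)\big)\big\}+c_0.$$ Each $S_\lambda$, $\lambda\in(0,\lambda_0)$, is nonempty. *)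

(* Defs.v *)
From HB Require Import structures.
From mathcomp Require Import all_boot all_order all_algebra.
From mathcomp Require Import all_classical all_reals all_analysis.

Set Implicit Arguments.
Unset Strict Implicit.
Unset Printing Implicit Defensive.

Import Order.TTheory GRing.Theory Num.Theory.
Import numFieldNormedType.Exports.

Local Open Scope classical_set_scope.
Local Open Scope ring_scope.

(* Nonempty metric spaces: the library requires a distinguished point in every
   measurable space, so nonemptiness is carried by the structure. *)
#[short(type="pmetricType")]
HB.structure Definition PointedMetric (R : numDomainType) :=
  {X of Metric R X & Pointed X}.

Definition is_min (R : realType) (A : set R) (m : R) : Prop :=
  A m /\ lbound A m.

Definition uncurry4 (R : realType) (X : pmetricType R)
    (f : X -> X -> R -> R -> R) : X * X * R * R -> R :=
  fun p => f p.1.1.1 p.1.1.2 p.1.2 p.2.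

Definition partial_u (R : realType) (X : pmetricType R)
    (l : X -> X -> R -> R -> R) : X -> X -> R -> R -> R :=
  fun x y u v => derive1 (fun s : R => l x y s v) u.

Definition partial_v (R : realType) (X : pmetricType R)
    (l : X -> X -> R -> R -> R) : X -> X -> R -> R -> R :=
  fun x y u v => derive1 (fun s : R => l x y u s) v.

(* The partial derivatives are required to be jointly continuous in all four
   variables, not only in (u, v). *)
Definition C1_in_uv (R : realType) (X : pmetricType R)
    (l : X -> X -> R -> R -> R) : Prop :=
  [/\ (forall x y u v, derivable (fun s : R => l x y s v) u 1),
      (forall x y u v, derivable (fun s : R => l x y u s) v 1),
      continuous (uncurry4 (partial_u l)) &
      continuous (uncurry4 (partial_v l))].

Definition at_zero (R : realType) (X : pmetricType R)
    (l : X -> X -> R -> R -> R) : X -> X -> R :=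
  fun x y => l x y 0 0.

Definition critical_constant (R : realType) (X : pmetricType R)
    (l0 : X -> X -> R) (c0 : R) : Prop :=
  exists u : X -> R, continuous u /\
    forall x, is_min (range (fun y => u y + l0 y x)) (u x - c0).

(* T with its Borel sigma-algebra; on X * X it is generated by the open sets of
   the product topology. *)
Definition borel (T : topologicalType) := g_sigma_algebraType (@open T).

Definition closed_measure (R : realType) (X : pmetricType R)
    (mu : probability (borel (X * X)%type) R) : Prop :=
  forall A : set (borel X), measurable A ->
    pushforward mu (fst : borel (X * X)%type -> borel X) A =
    pushforward mu (snd : borel (X * X)%type -> borel X) A.

Definition Mather_measure (R : realType) (X : pmetricType R)
    (l0 : X -> X -> R) (c0 : R)
    (mu : probability (borel (X * X)%type) R) : Prop :=
  closed_measure mu /\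
  (\int[mu]_p (l0 p.1 p.2)%:E = (- c0)%:E)%E.

Definition implicit_Lax_Oleinik_eq (R : realType) (X : pmetricType R)
    (l : X -> X -> R -> R -> R) (c0 lam : R) (phi psi : X -> R) : Prop :=
  forall x, is_min
    (range (fun z => phi z + l z x (lam * phi z) (lam * psi x)))
    (psi x - c0).

(* A definite description: for continuous phi and small lam > 0 the continuous
   solution psi exists and is unique, so the default value is irrelevant; it is
   chosen different from phi so that it could never create a fixed point. *)
Definition implicit_Lax_Oleinik (R : realType) (X : pmetricType R)
    (l : X -> X -> R -> R -> R) (c0 lam : R) (phi : X -> R) : X -> R :=
  xget (fun x => phi x + 1)
    [set psi : X -> R |
      continuous psi /\ implicit_Lax_Oleinik_eq l c0 lam phi psi].

Definition Lax_Oleinik_fixed_points (R : realType) (X : pmetricType R)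
    (l : X -> X -> R -> R -> R) (c0 lam : R) : set (X -> R) :=
  [set phi : X -> R |
    continuous phi /\ implicit_Lax_Oleinik l c0 lam phi = phi].

(* Main.v *)
Require Import Defs.
From HB Require Import structures.
From mathcomp Require Import all_boot all_order all_algebra.
From mathcomp Require Import all_classical all_reals all_analysis.
From mathcomp Require Import measurable_realfun ring lra.

Import Order.TTheory GRing.Theory Num.Theory.
Import numFieldNormedType.Exports.

Local Open Scope classical_set_scope.
Local Open Scope ring_scope.

(** Write e(z,x) = l(z,x,0,0) + c0 + u0(z) - u0(x) >= 0 for a weak KAM solution u0,
    and g = -(d_u l + d_v l)(.,.,0,0) >= 0. Empirical measures of backward orbits
    accumulate at closed measures, and a closed measure with \int e = 0 is a Mather
    measure, so \int g > 0 for it; hence the sums of g + C e along an orbit of length N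
    are at least eps N - C. This linear growth bounds the fixed points, and, after
    linearizing l at lam = 0 along a calibrated orbit of u_lam, makes the discounted
    sums of the product weights (1 - lam A_k) / (1 + lam B_k) of total mass O(1/lam).
    Comparing u_lam with a limit point w of fixed points, the defect of w being
    controlled by a fixed point of another, fixed, small discount, gives
    liminf u_lam >= w; so any two limit points coincide.

    Limits of empirical measures are constructed without a representation theorem: an
    ultrafilter limit gives a finitely additive set function on the Cantor space, which
    surjects onto X and carries codes of pairs by interleaving; its values on cylinders
    are realized by Lebesgue measure on [0,1[ through recursive interval splitting, and
    the image of Lebesgue measure in X * X is the desired measure. *)

Set Implicit Arguments.
Unset Strict Implicit.
Unset Printing Implicit Defensive.

(** * Finite prefixes of bit sequences *)

(* The most recent bit comes first. *)
Fixpoint initial_bits (z : nat -> bool) (n : nat) : seq bool :=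
  if n is k.+1 then z k :: initial_bits z k else [::].

Lemma eq_initial_bits z z' n :
  initial_bits z n = initial_bits z' n <-> forall i, (i < n)%N -> z i = z' i.
Proof.
elim: n => [|n IHn] //=; split.
- move=> [zn /IHn zi] i; rewrite ltnS leq_eqVlt => /orP[/eqP->//|]; exact: zi.
- move=> zi; rewrite (zi n)//; congr (_ :: _).
  by apply/IHn => i ltin; apply: zi; apply: ltnW.
Qed.

(** As [n] varies these are the clopen sets of the Cantor space. *)
Definition determined (n : nat) (D : set (nat -> bool)) :=
  forall z z', initial_bits z n = initial_bits z' n -> D z -> D z'.

(** * Coding points of [0,1[ by recursive splitting of intervals *)

Section interval_splitting.
Context {R : realType} (F : seq bool -> R).
Hypothesis F_ge0 : forall w, 0 <= F w.
Hypothesis F_nil : F [::] = 1.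
Hypothesis F_split : forall w, F w = F (false :: w) + F (true :: w).

(** The word [w] owns the interval from [left_end w] to [left_end w + F w]; its [false] child takes
    the left piece and its [true] child the right one. *)
Fixpoint left_end (w : seq bool) : R :=
  if w is b :: w' then left_end w' + (if b then F (false :: w') else 0) else 0.

Fixpoint bits_at (t : R) (n : nat) : seq bool :=
  if n is k.+1 then
    let w := bits_at t k in (left_end w + F (false :: w) <= t) :: w
  else [::].

Definition code (t : R) : nat -> bool := fun n => head false (bits_at t n.+1).

Lemma initial_bits_code t n : initial_bits (code t) n = bits_at t n.
Proof. by elim: n => //= n ->. Qed.

(** The interval of [w] is cut at [left_end w + F (false :: w)], and comparing [t] with the cut
    selects the child. If [t] misses the interval of [w], it misses both children, because [F] is
    nonnegative. *)
Lemma bits_atE t w : 0 <= t < 1 ->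
  (bits_at t (size w) == w) = (left_end w <= t < left_end w + F w).
Proof.
move=> t01; elim: w => [|b w IHw] /=; first by rewrite eqxx add0r F_nil t01.
rewrite eqseq_cons; have [eqw|neqw] := eqVneq (bits_at t (size w)) w.
  move: IHw; rewrite eqw eqxx => /esym/andP[lt1 lt2].
  move: lt2; rewrite F_split; case: b => lt2; rewrite andbT ?addr0.
    by rewrite eqb_id -addrA lt2 andbT.
  by rewrite lt1 /= eqbF_neg -ltNge.
move: IHw; rewrite (negbTE neqw) andbF => /esym/negbT IHw.
apply/esym/negbTE; apply: contra IHw => /andP[].
have := F_split w; have := F_ge0 (false :: w); have := F_ge0 (true :: w).
by case: b => ? ? ? ? ?; apply/andP; split; lra.
Qed.

Definition cylinder (w : seq bool) : set (nat -> bool) :=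
  [set z | initial_bits z (size w) = w].

Lemma code_cylinder w :
  [set` `[0, 1[%R] `&` code @^-1` cylinder w =
  [set` `[0, 1[%R] `&` [set` `[left_end w, left_end w + F w[%R].
Proof.
apply/seteqP; split=> t /= [+ tw]; rewrite in_itv /= => t01; split=> //; move: tw.
  by move=> tw; rewrite in_itv /= -bits_atE// -[bits_at _ _]initial_bits_code tw.
by rewrite in_itv /= -bits_atE// => /eqP; rewrite /cylinder /= initial_bits_code.
Qed.

Lemma left_end_bounds w : 0 <= left_end w /\ left_end w + F w <= 1.
Proof.
elim: w => [|b w [IH1 IH2]] /=; first by rewrite F_nil add0r.
have := F_split w; have := F_ge0 (false :: w); have := F_ge0 (true :: w).
by case: b => ? ? ?; split; lra.
Qed.

Lemma lebesgue_code_cylinder w :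
  lebesgue_measure ([set` `[0, 1[%R] `&` code @^-1` cylinder w) = (F w)%:E.
Proof.
have [le0 le1] := left_end_bounds w.
rewrite code_cylinder (_ : _ `&` _ = [set` `[left_end w, left_end w + F w[%R]).
  rewrite lebesgue_measure_itv /= lte_fin; case: ltP => [_|]; first by rewrite -EFinB; congr EFin; ring.
  by move=> le; congr EFin; have := F_ge0 w; lra.
apply/seteqP; split=> t /=; first by case.
by move=> tw; split=> //; move: tw; rewrite !in_itv /= => /andP[? ?]; apply/andP; split; lra.
Qed.

Lemma measurable_code_cylinder w :
  measurable ([set` `[0, 1[%R] `&` code @^-1` cylinder w).
Proof. by rewrite code_cylinder; apply: measurableI; exact: measurable_itv. Qed.

End interval_splitting.

(** * Lebesgue measure reproduces a finitely additive set function on clopen sets *)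

Section finitely_additive_realization.
Context {R : realType} (m : set (nat -> bool) -> R).
Hypothesis m_ge0 : forall A, 0 <= m A.
Hypothesis m_setT : m setT = 1.
Hypothesis m_setU : forall A B, A `&` B = set0 -> m (A `|` B) = m A + m B.

Let F w := m (cylinder w).
Let F_ge0 w : 0 <= F w. Proof. exact: m_ge0. Qed.
Let F_nil : F [::] = 1.
Proof. by rewrite /F -m_setT; congr m; apply/seteqP; split. Qed.

Lemma cylinder_split w : cylinder w = cylinder (false :: w) `|` cylinder (true :: w).
Proof.
rewrite /cylinder; apply/seteqP; split => z /=; last by case=> -[].
by move=> zw; rewrite zw; case: (z _); [right|left].
Qed.

Lemma cylinder_disjoint w : cylinder (false :: w) `&` cylinder (true :: w) = set0.
Proof. by apply/seteqP; split=> // z [] [zf _] []; rewrite zf. Qed.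

Let F_split w : F w = F (false :: w) + F (true :: w).
Proof. by rewrite /F {1}cylinder_split m_setU// cylinder_disjoint. Qed.

Let c := code F.

(** Induction on the number [n] of bits still open: once none is left, [D] contains the cylinder or
    misses it; before that the cylinder is halved. Finitely many halvings occur, so finite
    additivity of [m] is enough. *)
Lemma code_cylinder_determined n w D : determined (n + size w) D ->
  measurable ([set` `[0, 1[%R] `&` c @^-1` (cylinder w `&` D)) /\
  lebesgue_measure ([set` `[0, 1[%R] `&` c @^-1` (cylinder w `&` D)) =
    (m (cylinder w `&` D))%:E.
Proof.
elim: n w D => [|n IHn] w D detD.
  have [[z [wz Dz]]|noz] := pselect (cylinder w `&` D !=set0).
    have -> : cylinder w `&` D = cylinder w.
      apply/seteqP; split=> [y []//|y wy]; split=> //; apply: detD Dz.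
      by rewrite add0n wz wy.
    split; first exact: measurable_code_cylinder.
    exact: lebesgue_code_cylinder.
  have -> : cylinder w `&` D = set0.
    by apply/seteqP; split=> // y yD; case: noz; exists y.
  have m0 : m set0 = 0.
    by have := @m_setU set0 set0; rewrite setI0 setU0 => /(_ erefl) ?; lra.
  by rewrite preimage_set0 setI0 measure0 m0.
have splitD : cylinder w `&` D =
    (cylinder (false :: w) `&` D) `|` (cylinder (true :: w) `&` D).
  by rewrite [in LHS]cylinder_split setIUl.
have disjD : (cylinder (false :: w) `&` D) `&` (cylinder (true :: w) `&` D) = set0.
  by rewrite setIACA cylinder_disjoint set0I.
have [m1 e1] := IHn (false :: w) D ltac:(by rewrite /= addnS -addSn).
have [m2 e2] := IHn (true :: w) D ltac:(by rewrite /= addnS -addSn).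
rewrite splitD preimage_setU setIUr; split; first exact: measurableU.
rewrite m_setU// EFinD -e1 -e2; apply: measureU => //.
apply/seteqP; split=> // t [[_ t1] [_ t2]].
have : ((cylinder (false :: w) `&` D) `&` (cylinder (true :: w) `&` D)) (c t) by [].
by rewrite disjD.
Qed.

Lemma code_determined n D : determined n D ->
  measurable ([set` `[0, 1[%R] `&` c @^-1` D) /\
  lebesgue_measure ([set` `[0, 1[%R] `&` c @^-1` D) = (m D)%:E.
Proof.
move=> detD; have := @code_cylinder_determined n [::] D.
rewrite addn0 => /(_ detD).
by have -> : cylinder [::] `&` D = D by apply/seteqP; split=> [z []|z].
Qed.

End finitely_additive_realization.

(** * Ultrafilter limits of bounded functions *)

Section ultrafilter_limit.
Context {R : realType} (T : Type) (U : set_system T) {UU : UltraFilter U}.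

(** Compactness of the segment yields a cluster point, and an ultrafilter converges to each of its
    cluster points. *)
Lemma ultra_cvg (f : T -> R) (K : R) : (\forall t \near U, `|f t| <= K) -> f @ U --> lim (f @ U).
Proof.
move=> fK; have UP : ProperFilter U by exact: ultra_proper.
have fU : (f @ U) [set` `[- K, K]].
  by apply: filterS fK => t; rewrite /= in_itv /= -ler_norml.
have [p [_ clp]] := @segment_compact R (- K) K (f @ U) _ fU.
have fp : f @ U --> p.
  move=> V Vp; have [//|UV] := in_ultra_setVsetC (f @^-1` V) UU.
  by have [x []] := clp (~` V) V UV Vp.
exact: (cvgP p fp).
Qed.

End ultrafilter_limit.

(** * Cylinders and interleaving in the Cantor space *)

Lemma cantor_nbhs (z : cantor_space) (A : set cantor_space) : nbhs z A ->
  exists n, forall z', initial_bits z n = initial_bits z' n -> A z'.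
Proof.
pose G := filter_from [set: nat]
  (fun n => [set z' : cantor_space | initial_bits z n = initial_bits z' n]).
have FG : Filter G.
  apply: filter_from_filter; first by exists 0%N.
  move=> i j _ _; exists (maxn i j) => // y /eq_initial_bits yz.
  by split; apply/eq_initial_bits => k lt; apply: yz; rewrite leq_max lt ?orbT.
(* Convergence in the product is tested coordinatewise, and coordinate [i] is fixed by the first
   [i.+1] bits. *)
have Gz : G --> z.
  apply/cvg_sup => i U.
  have /= -> := @nbhsE (initial_topology (fun f : cantor_space => f i)) z.
  case=> B [[C oC <-] zC] /filterS; apply.
  by exists i.+1 => // y /eq_initial_bits zy; rewrite /= in zC *; rewrite -zy.
by move=> /Gz[n _ nA]; exists n => z' ?; exact: nA.
Qed.

Definition even_bits (z : cantor_space) : cantor_space := fun i => z i.*2.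
Definition odd_bits (z : cantor_space) : cantor_space := fun i => z i.*2.+1.
Definition interleave (a b : cantor_space) : cantor_space :=
  fun i => if odd i then b i./2 else a i./2.

Lemma interleave_even a b : even_bits (interleave a b) = a.
Proof. by apply/funext => i; rewrite /even_bits /interleave odd_double doubleK. Qed.

Lemma interleave_odd a b : odd_bits (interleave a b) = b.
Proof.
by apply/funext => i; rewrite /odd_bits /interleave /= odd_double /= uphalf_double.
Qed.

Lemma initial_even_bits z z' n : initial_bits z n.*2 = initial_bits z' n.*2 ->
  initial_bits (even_bits z) n = initial_bits (even_bits z') n.
Proof.
by move=> /eq_initial_bits zz; apply/eq_initial_bits => i lt; apply: zz; rewrite ltn_double.
Qed.

Lemma initial_odd_bits z z' n : initial_bits z n.*2 = initial_bits z' n.*2 ->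
  initial_bits (odd_bits z) n = initial_bits (odd_bits z') n.
Proof.
move=> /eq_initial_bits zz; apply/eq_initial_bits => i lt; apply: zz.
by rewrite -doubleS leq_double.
Qed.

Lemma continuous_fst {S T : topologicalType} : continuous (fst : S * T -> S).
Proof. by move=> [a b] V aV; exists (V, setT) => [|[? ?] []//]; split=> //=; exact: filterT. Qed.

Lemma continuous_snd {S T : topologicalType} : continuous (snd : S * T -> T).
Proof. by move=> [a b] V bV; exists (setT, V) => [|[? ?] []//]; split=> //=; exact: filterT. Qed.

(** * The two projections as Borel maps *)

Section projections.
Context {R : realType} (X : pmetricType R).

Lemma borel_measurable_map (g : X * X -> X) : continuous g ->
  measurable_fun setT (g : borel (X * X)%type -> borel X).
Proof.
move=> cg; apply: (@measurability _ _ (borel (X * X)%type) (borel X) setT g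
  (@open X)) => // _ [V oV <-].
by rewrite setTI; apply: sub_sigma_algebra; apply: open_comp => // ? _; exact: cg.
Qed.

Definition fst_mfun : {mfun borel (X * X)%type >-> borel X} :=
  HB.pack (fst : borel (X * X)%type -> borel X)
    (isMeasurableFun.Build _ _ _ _ (fst : borel (X * X)%type -> borel X)
      (borel_measurable_map continuous_fst)).

Definition snd_mfun : {mfun borel (X * X)%type >-> borel X} :=
  HB.pack (snd : borel (X * X)%type -> borel X)
    (isMeasurableFun.Build _ _ _ _ (snd : borel (X * X)%type -> borel X)
      (borel_measurable_map continuous_snd)).

End projections.

(** * From a shift-invariant mean to a closed Borel probability *)

Section measure_of_mean.
Context {R : realType} (X : pmetricType R).
Variable m : set (nat -> bool) -> R.
Hypothesis m_ge0 : forall A, 0 <= m A.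
Hypothesis m_setT : m setT = 1.
Hypothesis m_setU : forall A B, A `&` B = set0 -> m (A `|` B) = m A + m B.
Hypothesis m_shift : forall A, m (even_bits @^-1` A) = m (odd_bits @^-1` A).
Variable f : cantor_space -> X.
Hypothesis f_cont : continuous f.

Let c : R -> cantor_space := code (fun w => m (cylinder w)).
Let I := [set` `[0, 1[%R] : set R.
Let mI : measurable I. Proof. exact: measurable_itv. Qed.
Let pair_of (z : cantor_space) : X * X := (f (even_bits z), f (odd_bits z)).

(** The union of the cylinders of length [n] inside the preimage of [V]: for open [V] these clopen
    sets increase to the whole preimage. *)
Let interior_cylinders (T : Type) (g : cantor_space -> T) (V : set T) n :
  set (nat -> bool) :=
  [set z | forall z', initial_bits z n = initial_bits z' n -> V (g z')].

Let determined_interior T (g : cantor_space -> T) V n :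
  determined n (@interior_cylinders T g V n).
Proof. by move=> z z' zz Vz y zy; apply: Vz; rewrite zz. Qed.

Let interior_cylinders_sub T (g : cantor_space -> T) V n :
  @interior_cylinders T g V n `<=` g @^-1` V.
Proof. by move=> z; exact. Qed.

Let interior_cylinders_nd T (g : cantor_space -> T) V :
  nondecreasing_seq (@interior_cylinders T g V).
Proof.
move=> i j leij; apply/subsetPset => z Vz y /eq_initial_bits zy.
by apply: Vz; apply/eq_initial_bits => k lt; apply: zy; exact: leq_trans leij.
Qed.

Let locally_cylindrical T (g : cantor_space -> T) (V : set T) :=
  forall z, V (g z) ->
  exists n, forall z', initial_bits z n = initial_bits z' n -> V (g z').

Let bigcup_interior_cylinders T (g : cantor_space -> T) V :
  locally_cylindrical g V ->
  \bigcup_n @interior_cylinders T g V n = g @^-1` V.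
Proof.
move=> oV; apply/seteqP; split; first by move=> z [n _ /interior_cylinders_sub].
by move=> z /oV[n nV]; exists n.
Qed.

Let m_mono A B : A `<=` B -> m A <= m B.
Proof.
move=> AB; rewrite (_ : B = A `|` (B `\` A)) ?m_setU ?lerDl//.
  by rewrite setDE setICA setICr setI0.
apply/seteqP; split=> [z Bz|z [/AB//|[]//]].
by have [Az|nAz] := pselect (A z); [left|right].
Qed.

Let locally_f V : open V -> locally_cylindrical f V.
Proof.
by move=> oV z Vz; have /cantor_nbhs := f_cont (open_nbhs_nbhs (conj oV Vz)).
Qed.

Let locally_pair V : open V -> locally_cylindrical pair_of V.
Proof.
move=> oV z Vz; have [[A B] /= [Az Bz] AB] := open_nbhs_nbhs (conj oV Vz).
have /cantor_nbhs[i iA] := f_cont Az; have /cantor_nbhs[j jB] := f_cont Bz.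
exists (i + j).*2 => z' /eq_initial_bits zz.
apply: (AB (_, _)); split => /=.
- apply/iA/initial_even_bits/eq_initial_bits => k lt; apply: zz.
  by rewrite doubleD ltn_addr.
- apply/jB/initial_odd_bits/eq_initial_bits => k lt; apply: zz.
  by rewrite doubleD ltn_addl.
Qed.

(** Continuity from below of Lebesgue measure supplies the countable additivity that is not assumed
    of [m]. *)
Let leb_cvg (D : (set (nat -> bool))^nat) (k : nat -> nat) :
  (forall n, determined (k n) (D n)) -> nondecreasing_seq D ->
  measurable (I `&` c @^-1` (\bigcup_n D n)) /\
  (fun n => (m (D n))%:E) @ \oo --> lebesgue_measure (I `&` c @^-1` (\bigcup_n D n)).
Proof.
move=> detD ndD; pose F n := I `&` c @^-1` D n.
have mF n : measurable (F n) by apply: (code_determined _ _ _ (detD n)).1.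
have mUF : measurable (\bigcup_n F n) by exact: bigcupT_measurable.
have -> : I `&` c @^-1` (\bigcup_n D n) = \bigcup_n F n.
  by rewrite -setI_bigcupr -preimage_bigcup.
split=> //; rewrite (_ : (fun n => _) = lebesgue_measure \o F); last first.
  by apply/funext => n; apply/esym; apply: (code_determined _ _ _ (detD n)).2.
apply: nondecreasing_cvg_mu => // i j leij; apply/subsetPset => t [It zt].
by split=> //; have /subsetPset := ndD _ _ leij; apply.
Qed.

(** The value outside [0,1[ only makes [p] total: [nu] is restricted to [I]. *)
Let p (t : R) : X * X := pair_of (c (if t \in `[0, 1[%R then t else 0)).

Let preimage_p V : I `&` (p @^-1` V) = I `&` c @^-1` (pair_of @^-1` V).
Proof. by apply/seteqP; split=> t [/= tI]; rewrite /p tI. Qed.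

Let p_out t : (~` I) t -> p t = pair_of (c 0).
Proof. by rewrite /p; case: ifP => // tI []. Qed.

Let measurable_p : measurable_fun [set: R] (p : R -> borel (X * X)%type).
Proof.
apply: (@measurability _ _ (measurableTypeR R) (borel (X * X)%type) setT p
  (@open (X * X)%type)) => // _ [V oV <-].
rewrite setTI (_ : p @^-1` V = (I `&` p @^-1` V) `|` (~` I `&` p @^-1` V)); last first.
  by rewrite -setIUl setUv setTI.
apply: measurableU; last first.
  have [V0|nV0] := pselect (V (pair_of (c 0))).
    rewrite (_ : _ `&` _ = ~` I); first exact: measurableC.
    by apply/seteqP; split=> t; [case|move=> tI; split=> //=; rewrite p_out].
  rewrite (_ : _ `&` _ = set0)//.
  by apply/seteqP; split=> // t [tI]; rewrite /= p_out.
rewrite preimage_p -bigcup_interior_cylinders; last exact: locally_pair.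
have [h _] := leb_cvg (@determined_interior _ pair_of V) (@interior_cylinders_nd _ pair_of V).
exact: h.
Qed.

Let nu : {measure set (measurableTypeR R) -> \bar R} := mrestr (@lebesgue_measure R) mI.

Let nu_setT : nu setT = 1%E.
Proof.
by rewrite /nu /= /mrestr setTI lebesgue_measure_itv /= lte_fin ltr01 oppr0 adde0.
Qed.

Let nu_probability : probability (measurableTypeR R) R :=
  HB.pack_for (probability (measurableTypeR R) R) (Measure.sort nu)
    (Measure_isProbability.Build _ _ _ nu nu_setT).

Let p_mfun : {mfun measurableTypeR R >-> borel (X * X)%type} :=
  HB.pack (p : measurableTypeR R -> borel (X * X)%type)
    (isMeasurableFun.Build _ _ _ _ (p : measurableTypeR R -> borel (X * X)%type) measurable_p).

Let mu : probability (borel (X * X)%type) R := distribution nu_probability p_mfun.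

Let muE V : mu V = lebesgue_measure (I `&` c @^-1` (pair_of @^-1` V)).
Proof. by rewrite -preimage_p setIC. Qed.

(** On an open set [mu] is the limit of the values of [m] on clopen subsets of the preimage, hence
    at most the value of [m] on the preimage. Equality may fail, so only nullity is passed on. *)
Lemma measure_of_mean : exists mu : probability (borel (X * X)%type) R,
  closed_measure mu /\
  forall V : set (X * X)%type, open V ->
    m [set z | V (f (even_bits z), f (odd_bits z))] = 0 -> mu V = 0%E.
Proof.
exists mu; split; last first.
  move=> V oV mV0; rewrite muE.
  rewrite -bigcup_interior_cylinders; last exact: locally_pair.
  have [_] := leb_cvg (@determined_interior _ pair_of V) (@interior_cylinders_nd _ pair_of V).
  rewrite (_ : (fun n => _) = cst 0%E); last first.
    apply/funext => n; congr EFin; apply/eqP; rewrite eq_le m_ge0 andbT -mV0.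
    by apply: m_mono; exact: interior_cylinders_sub.
  by move=> /(cvg_lim (@ereal_hausdorff R)) <-; rewrite lim_cst//; exact: ereal_hausdorff.
(* Both marginals of [V] are limits along the same clopen sets, read once on the even and once on
   the odd bits; [m_shift] equates them term by term. *)
have open_eq V : open V -> distribution mu (fst_mfun X) V = distribution mu (snd_mfun X) V.
  move=> oV; rewrite /distribution /pushforward.
  transitivity (lebesgue_measure (I `&` c @^-1` (even_bits @^-1` (f @^-1` V)))).
    exact: muE.
  transitivity (lebesgue_measure (I `&` c @^-1` (odd_bits @^-1` (f @^-1` V)))); last first.
    by apply/esym; exact: muE.
  rewrite -(bigcup_interior_cylinders (locally_f oV)).
  rewrite !preimage_bigcup.
  have nd_preimage (b : cantor_space -> cantor_space) :
      nondecreasing_seq (fun n => b @^-1` interior_cylinders f V n).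
    move=> i j leij; apply/subsetPset => t.
    by have /subsetPset := @interior_cylinders_nd _ f V _ _ leij; apply.
  have det_preimage (b : cantor_space -> cantor_space) :
      (forall z z' n, initial_bits z n.*2 = initial_bits z' n.*2 ->
        initial_bits (b z) n = initial_bits (b z') n) ->
      forall n, determined n.*2 (b @^-1` interior_cylinders f V n).
    by move=> bb n z z' /bb; exact: determined_interior.
  have [_ lim1] := leb_cvg (@det_preimage _ initial_even_bits) (@nd_preimage even_bits).
  have [_ lim2] := leb_cvg (@det_preimage _ initial_odd_bits) (@nd_preimage odd_bits).
  move: lim1; under eq_fun do rewrite m_shift.
  move=> /(cvg_lim (@ereal_hausdorff R)) <-.
  by move: lim2 => /(cvg_lim (@ereal_hausdorff R)) <-.
(* Open sets are stable under intersection and generate the Borel sets, so two finite measures that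
   agree on them coincide. *)
move=> A mA.
have := @g_sigma_algebra_measure_unique _ R (borel X) (@open X) _ (fun=> setT) _ _
  (distribution mu (fst_mfun X)) (distribution mu (snd_mfun X)) _ open_eq _ A mA.
apply=> //.
- by move=> V oV; exact: sub_sigma_algebra.
- by move=> _; exact: openT.
- by rewrite bigcup_const//; exists 0%N.
- by move=> V W; exact: openI.
- by move=> _; rewrite [X in (X < _)%E](probability_setT (distribution mu (fst_mfun X))) ltry.
Qed.

End measure_of_mean.

(** * Limits of empirical measures of backward orbits *)

Section closed_weak_limit.
Context {R : realType} (X : pmetricType R).
Hypothesis X_compact : compact [set: X].

(** The orbit [y] runs backward in time: [y k.+1] is the predecessor of [y k] and comes first in the
    pair, as in [l z x]. *)
Definition frequency (N : nat) (y : nat -> X) (V : set (X * X)) : R :=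
  (\sum_(k < N) (`[< V (y k.+1, y k) >])%:R) / N%:R.

(** Points are replaced by codes chosen through a section [s] of a continuous surjection [f] from
    the Cantor space. The empirical frequencies then live on sets of bit sequences, where their
    ultrafilter limit is a mean [m]. *)
Lemma closed_weak_limit (N : nat -> nat) (y : nat -> nat -> X) :
  (forall n, (n < N n)%N) ->
  exists mu : probability (borel (X * X)%type) R, closed_measure mu /\
  forall V : set (X * X)%type, open V ->
    (fun n => frequency (N n) (y n) V) @ \oo --> 0 -> mu V = 0%E.
Proof.
move=> ltN; have [f f_cont] := @cantor_surj R X X_compact (@metric_hausdorff _ X).
have f_surj x : exists z, f z = x.
  by have [z _ <-] := @surj _ _ _ _ f x Logic.I; exists z.
have [s fs] := choice f_surj.
have [U [UU leU]] := @ultraFilterLemma nat \oo _.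
pose a n (A : set (nat -> bool)) : R :=
  (\sum_(k < N n) (`[< A (interleave (s (y n k.+1)) (s (y n k))) >])%:R) / (N n)%:R.
have N_gt0 n : 0 < (N n)%:R :> R by rewrite ltr0n (leq_ltn_trans _ (ltN n)).
have a_ge0 n A : 0 <= a n A by rewrite divr_ge0 ?sumr_ge0.
have a_le1 n A : a n A <= 1.
  rewrite ler_pdivrMr// mul1r -[X in _ <= X%:R]card_ord -sum1_card natr_sum.
  by apply: ler_sum => k _; rewrite ler_nat leq_b1.
have aK A n : `|a n A| <= 1 by rewrite ger0_norm.
have UP : ProperFilter U by exact: ultra_proper.
have Hcvg A : (fun n => a n A) @ U --> lim ((fun n => a n A) @ U) by exact: ultra_cvg (nearW _ (aK A)).
pose m A := lim ((fun n => a n A) @ U).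
have m_eq A l : (fun n => a n A) @ U --> l -> m A = l.
  by move=> /(cvg_lim (@Rhausdorff R)).
have m_ge0 A : 0 <= m A.
  by apply: limr_ge; [exact: Hcvg|exact: nearW].
have m_setT : m setT = 1.
  apply: m_eq; rewrite (_ : (fun n => _) = cst 1); first exact: cvg_cst.
  apply/funext => n; rewrite /a; under eq_bigr do rewrite asboolT//.
  by rewrite sumr_const card_ord divff// gt_eqF.
have m_setU A B : A `&` B = set0 -> m (A `|` B) = m A + m B.
  move=> AB; apply: m_eq.
  rewrite (_ : (fun n => _) = (fun n => a n A + a n B)); first exact: cvgD.
  apply/funext => n; rewrite /a -mulrDl -big_split/=; congr (_ / _).
  apply: eq_bigr => k _; set z := interleave _ _.
  have [Az|nAz] := asboolP (A z); have [Bz|nBz] := asboolP (B z).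
  - by have : (A `&` B) z by []; rewrite AB.
  - by rewrite asboolT ?addr0//; left.
  - by rewrite asboolT ?add0r//; right.
  - by rewrite asboolF ?addr0// => -[].
(* The marginals of an empirical measure differ only by the two endpoints of the orbit: the
   difference telescopes and is at most 1 / [N n], which is at most 1 / (n + 1). *)
have shift0 A : (fun n => a n (even_bits @^-1` A) - a n (odd_bits @^-1` A)) @ \oo --> 0.
  apply/norm_cvg0P; apply: (squeeze_cvgr _ (cvg_cst 0) cvg_harmonic).
  near=> n; rewrite normr_ge0 /=.
  rewrite /a -mulrBl -sumrB.
  under eq_bigr do rewrite /= interleave_even interleave_odd.
  rewrite -(big_mkord xpredT (fun k => (`[< A (s (y n k.+1)) >])%:R - (`[< A (s (y n k)) >])%:R)).
  rewrite (GRing.telescope_sumr (fun k => (`[< A (s (y n k)) >])%:R : R))//.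
  rewrite normrM normfV [`|(N n)%:R|]ger0_norm//.
  rewrite /harmonic /= -[leRHS]mul1r ler_pM// ?lef_pV2 ?posrE ?ler_nat//.
  by case: `[< _ >]; case: `[< _ >]; rewrite ?subrr ?subr0 ?sub0r ?normrN ?normr0 ?normr1.
have m_shift A : m (even_bits @^-1` A) = m (odd_bits @^-1` A).
  apply: m_eq; rewrite -[m _]add0r.
  rewrite (_ : (fun n => _) = (fun n => (a n (even_bits @^-1` A) - a n (odd_bits @^-1` A))
    + a n (odd_bits @^-1` A))); last by apply/funext => n; rewrite subrK.
  apply: cvgD; last exact: Hcvg.
  by apply: cvg_trans (shift0 A); exact: cvg_app.
have [mu [mu_closed mu0]] := measure_of_mean m_ge0 m_setT m_setU m_shift f_cont.
exists mu; split=> // V oV V0; apply: mu0 => //; apply: m_eq.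
apply: cvg_trans V0; rewrite (_ : (fun n => _) = (fun n => frequency (N n) (y n) V)).
  exact: cvg_app.
apply/funext => n; rewrite /a /frequency; congr (_ / _).
by apply: eq_bigr => k _ /=; rewrite interleave_even interleave_odd !fs.
Unshelve. all: by end_near. Qed.

End closed_weak_limit.

(** * Integrals of continuous functions against Borel measures *)

HB.saturate prod.

Lemma borel_measurable_fun {R : realType} (T : ptopologicalType) (g : T -> R) :
  continuous g -> measurable_fun [set: borel T] (g : borel T -> R).
Proof.
move=> /continuousP cg.
apply: (@measurability _ _ (borel T) R setT g _ (RGenOpens.measurableE R)).
move=> _ [_ [a [b ->] <-]]; rewrite setTI; apply: sub_sigma_algebra.
exact/cg/interval_open.
Qed.

(** The set where [g] is positive is the countable union of the null sets where [g] exceeds 1 / (n +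
    1). *)
Lemma integral_null_superlevel {R : realType} (T : ptopologicalType)
    (mu : {measure set (borel T) -> \bar R}) (g : T -> R) :
  continuous g -> (forall t, 0 <= g t) ->
  (forall d, 0 < d -> mu [set t | d < g t] = 0%E) ->
  (\int[mu]_t (g t)%:E = 0)%E.
Proof.
move=> cg g_ge0 null.
rewrite (@ae_eq_integral _ (borel T) R mu setT (cst 0%E)) ?integral_cst ?mul0e//.
  by apply/measurable_EFinP; exact: borel_measurable_fun.
have : mu.-negligible (\bigcup_n [set t | n.+1%:R^-1 < g t]).
  apply: negligible_bigcup => n; apply/negligibleP; last by apply: null; rewrite invr_gt0.
  apply: sub_sigma_algebra; move/continuousP : cg => /(_ [set x | n.+1%:R^-1 < x]); apply.
  exact: open_gt.
apply: negligibleS => t /= /not_implyP[_ gt0].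
have {}gt0 : 0 < g t.
  by rewrite lt_neqAle g_ge0 andbT eq_sym; apply: contra_notN gt0 => /eqP ->.
exists (Num.truncn (g t)^-1) => //=.
by rewrite -[ltRHS]invrK ltf_pV2 ?posrE ?invr_gt0// truncnS_gt.
Qed.

Lemma continuous_bounded {R : realType} (T : topologicalType) (g : T -> R) :
  compact [set: T] -> continuous g -> exists2 K, 0 <= K & forall t, `|g t| <= K.
Proof.
move=> cT cg; have [M [_ MP]] : bounded_set (g @` setT).
  apply: compact_bounded; apply: continuous_compact => //.
  exact: continuous_subspaceT.
exists (`|M| + 1); first by rewrite addr_ge0.
move=> t; have /MP : M < `|M| + 1 by rewrite (le_lt_trans (ler_norm _))// ltrDl.
by apply; exists t.
Qed.

Lemma integrable_continuous {R : realType} (T : ptopologicalType)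
    (mu : probability (borel T) R) (g : T -> R) :
  compact [set: T] -> continuous g -> mu.-integrable [set: borel T] (EFin \o g).
Proof.
move=> cT cg; have [K _ gK] := continuous_bounded cT cg.
apply: (@le_integrable _ _ _ mu setT measurableT _ (cst K%:E)).
- by apply/measurable_EFinP; exact: borel_measurable_fun.
- by move=> t _ /=; rewrite lee_fin (le_trans (gK t))// ler_norm.
- exact: finite_measure_integrable_cst.
Qed.

(** * Closed measures and linear growth of orbit sums *)

Section closed_measures.
Context {R : realType} (X : pmetricType R).
Hypothesis X_compact : compact [set: X].

Lemma compact_pairs : compact [set: X * X].
Proof. by rewrite -setXTT; exact: compact_setX. Qed.

Lemma closed_measure_integral (mu : probability (borel (X * X)%type) R) (u : X -> R) :
  closed_measure mu -> continuous u ->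
  (\int[mu]_p (u p.1)%:E = \int[mu]_p (u p.2)%:E)%E.
Proof.
move=> mu_closed cu.
have comp_cont (g : X * X -> X) : continuous g -> continuous (u \o g).
  by move=> cg x; apply: continuous_comp; [exact: cg|exact: cu].
have mu_u : measurable_fun [set: borel X] (EFin \o u).
  by apply/measurable_EFinP; exact: borel_measurable_fun.
have <- := @integral_distribution _ _ _ _ R mu (fst_mfun X) (EFin \o u) mu_u
  (@integrable_continuous R (X * X)%type mu _ compact_pairs (comp_cont _ (@continuous_fst X X))).
have <- := @integral_distribution _ _ _ _ R mu (snd_mfun X) (EFin \o u) mu_u
  (@integrable_continuous R (X * X)%type mu _ compact_pairs (comp_cont _ (@continuous_snd X X))).
by apply: eq_measure_integral => A mA _; exact: mu_closed.
Qed.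

Definition orbit_sum (g : X * X -> R) (N : nat) (y : nat -> X) : R :=
  \sum_(k < N) g (y k.+1, y k).

(** Markov's inequality for the empirical measure. *)
Lemma frequency_superlevel (g : X * X -> R) N y (d : R) : (0 < N)%N -> 0 < d ->
  (forall p, 0 <= g p) ->
  frequency N y [set p | d < g p] <= orbit_sum g N y / N%:R / d.
Proof.
move=> N0 d0 g0; rewrite /frequency /orbit_sum mulrAC ler_pM2r ?invr_gt0 ?ltr0n//.
rewrite ler_pdivlMr// mulr_suml; apply: ler_sum => k _.
by case: asboolP => [/ltW|_]; rewrite ?mul1r ?mul0r.
Qed.

(* If the bound failed for all constants, the empirical measures of the offending
   orbits would accumulate at a closed measure with \int e = \int g = 0. *)
Lemma orbit_growth (e g : X * X -> R) :
  continuous e -> continuous g -> (forall p, 0 <= e p) -> (forall p, 0 <= g p) ->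
  (forall mu : probability (borel (X * X)%type) R, closed_measure mu ->
    (\int[mu]_p (e p)%:E = 0)%E -> (\int[mu]_p (g p)%:E <> 0)%E) ->
  exists eps C : R, [/\ 0 < eps, 0 <= C &
    forall y N, eps * N%:R - C <= orbit_sum g N y + C * orbit_sum e N y].
Proof.
move=> ce cg e0 g0 eg; apply: contrapT => nogrowth.
(* The constants refuted at stage [n] are eps = 1 / (n + 1) and C = n + 1. *)
have {nogrowth} bad n : exists yN : (nat -> X) * nat,
    orbit_sum g yN.2 yN.1 + n.+1%:R * orbit_sum e yN.2 yN.1 <
    n.+1%:R^-1 * yN.2%:R - n.+1%:R.
  apply: contrapT => nobad; apply: nogrowth; exists n.+1%:R^-1, n.+1%:R.
  split; rewrite ?invr_gt0// => y N; rewrite leNgt; apply/negP => lt.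
  by apply: nobad; exists (y, N).
have [F FP] := choice bad.
pose y n := (F n).1; pose N n := (F n).2.
have e_sum0 n : 0 <= orbit_sum e (N n) (y n) by apply: sumr_ge0.
have g_sum0 n : 0 <= orbit_sum g (N n) (y n) by apply: sumr_ge0.
(* Nonnegative orbit sums make the right-hand side of [bad] positive, so [N n] exceeds the square of
   n + 1. *)
have ltN n : (n < N n)%N.
  have pos : 0 < n.+1%:R^-1 * (N n)%:R - n.+1%:R :> R.
    apply: le_lt_trans (FP n); apply: addr_ge0; first exact: g_sum0.
    by apply: mulr_ge0; [exact: ler0n|exact: e_sum0].
  rewrite -(ltr_nat R); apply: (@lt_le_trans _ _ n.+1%:R); first by rewrite ltr_nat.
  rewrite subr_gt0 mulrC ltr_pdivlMr// in pos; apply/ltW/(le_lt_trans _ pos).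
  by rewrite ler_peMr// ler1n.
have sum_small n : orbit_sum g (N n) (y n) + orbit_sum e (N n) (y n) <= n.+1%:R^-1 * (N n)%:R.
  apply: le_trans (ltW _) (_ : n.+1%:R^-1 * (N n)%:R - n.+1%:R <= _); last by rewrite lerBlDr lerDl.
  apply: le_lt_trans (FP n); rewrite lerD2l ler_peMl ?ler1n//; exact: e_sum0.
have [mu [mu_closed mu0]] := @closed_weak_limit R X X_compact N y ltN.
have N_gt0 n : 0 < (N n)%:R :> R by rewrite ltr0n (leq_ltn_trans _ (ltN n)).
have null (h : X * X -> R) : continuous h -> (forall p, 0 <= h p) ->
    (forall n, orbit_sum h (N n) (y n) <= n.+1%:R^-1 * (N n)%:R) ->
    (\int[mu]_p (h p)%:E = 0)%E.
  move=> ch h0 hsmall.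
  apply: (@integral_null_superlevel R (X * X)%type mu h ch h0) => d d0; apply: mu0.
    by move/continuousP : ch => /(_ [set x | d < x]); apply; exact: open_gt.
  apply: (squeeze_cvgr _ (cvg_cst 0) (_ : (fun n => harmonic n / d) @ \oo --> 0)); last first.
    by rewrite -[X in _ --> X](mul0r d^-1); apply: cvgMl; exact: cvg_harmonic.
  near=> n; apply/andP; split.
    by rewrite divr_ge0// sumr_ge0.
  apply: le_trans (frequency_superlevel _ _ d0 h0) _; first exact: leq_ltn_trans (ltN n).
  by rewrite ler_pM2r ?invr_gt0// ler_pdivrMr//; exact: hsmall.
apply: (eg mu mu_closed); apply: null => // n; apply: le_trans (sum_small n).
  by rewrite lerDr.
by rewrite lerDl.
Unshelve. all: by end_near. Qed.

End closed_measures.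

(** * Summation by parts and discounted sums *)

Lemma sum_sub_succ {R : realFieldType} (q : nat -> R) N :
  \sum_(k < N) (q k - q k.+1) = q 0%N - q N.
Proof.
elim: N => [|N IHN]; first by rewrite big_ord0 subrr.
by rewrite big_ord_recr /= IHN; ring.
Qed.

(** Summation by parts: the weighted sum is a combination of the partial sums of [x] with
    nonnegative coefficients of total [gam 0%N] <= 1. The inequality [H] carries this through the
    induction. *)
Lemma abel_lower {R : realFieldType} (gam x : nat -> R) (c : R) :
  (forall k, 0 <= gam k) -> (forall k, gam k.+1 <= gam k) -> gam 0%N <= 1 -> 0 <= c ->
  (forall N, - c <= \sum_(k < N) x k) ->
  forall N, - c <= \sum_(k < N) gam k * x k.
Proof.
move=> gam0 gamS gam1 c0 xc N; case: N => [|N]; first by rewrite big_ord0 oppr_le0.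
have H n : gam n * (\sum_(k < n.+1) x k + c) - c * gam 0%N <= \sum_(k < n.+1) gam k * x k.
  elim: n => [|n IHn]; first by rewrite !big_ord_recr !big_ord0 /= !add0r; lra.
  rewrite big_ord_recr [leRHS]big_ord_recr /=.
  have := xc n.+1; set S := \sum_(k < n.+1) x k in IHn *; move=> Sc.
  have : gam n.+1 * (S + c) <= gam n * (S + c) by rewrite ler_wpM2r//; lra.
  lra.
apply: le_trans (H N).
have : 0 <= gam N * (\sum_(k < N.+1) x k + c) by rewrite mulr_ge0//; have := xc N.+1; lra.
have : c * gam 0%N <= c by rewrite ler_piMr.
lra.
Qed.

Section discounted_sums.
Context {R : realType}.
Variables (lam mu C eps K M rho : R) (A B e p q h delta : nat -> R).
Hypotheses (lam_gt0 : 0 < lam) (lam_le1 : lam <= 1) (mu_gt0 : 0 < mu)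
  (eps_gt0 : 0 < eps) (C_ge0 : 0 <= C) (K_ge0 : 0 <= K) (rho_ge0 : 0 <= rho).
Hypotheses (A_ge0 : forall k, 0 <= A k) (B_ge0 : forall k, 0 <= B k)
  (lamA_le1 : forall k, lam * A k <= 1).
Hypothesis growth : forall N,
  eps * N%:R - C <= \sum_(k < N) (A k + B k) + C * \sum_(k < N) e k.
Hypothesis e_le : forall k, e k <= p k - p k.+1 + lam * M.
Hypothesis delta_ge : forall k,
  (1 - lam * A k) * delta k.+1 + lam * h k <= (1 + lam * B k) * delta k.
Hypothesis h_ge : forall k, (q k - q k.+1) / mu - rho <= h k.
Hypotheses (p_le : forall k, `|p k| <= K) (q_le : forall k, `|q k| <= K)
  (delta_le : forall k, `|delta k| <= K).
Hypothesis lam_small : C * (lam * M) <= eps / 2.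

(** The weights are chosen so that [delta_ge], multiplied by [gam k], reads beta_{k+1} delta_{k+1} +
    lam gam_k h_k <= beta_k delta_k and telescopes. *)
Fixpoint beta (n : nat) : R :=
  if n is k.+1 then beta k / (1 + lam * B k) * (1 - lam * A k) else 1.
Let gam k := beta k / (1 + lam * B k).

Let B1 k : 1 <= 1 + lam * B k.
Proof. by rewrite lerDl mulr_ge0// ltW. Qed.

Let B1_gt0 k : 0 < 1 + lam * B k.
Proof. exact: lt_le_trans (B1 k). Qed.

Let beta_ge0 k : 0 <= beta k.
Proof.
elim: k => [|k IHk] //=; apply: mulr_ge0; first by rewrite divr_ge0// ltW.
by rewrite subr_ge0.
Qed.

Let gam_ge0 k : 0 <= gam k.
Proof. by rewrite divr_ge0// ltW. Qed.

Let gam_le_beta k : gam k <= beta k.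
Proof. by rewrite ler_pdivrMr// ler_peMr. Qed.

Let beta_le_gam k : beta k.+1 <= gam k.
Proof.
apply: ler_piMr; first exact: gam_ge0.
by rewrite gerBl; apply: mulr_ge0 => //; exact: ltW.
Qed.

Let gamS k : gam k.+1 <= gam k.
Proof. exact: le_trans (gam_le_beta _) (beta_le_gam _). Qed.

Let gam_le i j : (i <= j)%N -> gam j <= gam i.
Proof.
move=> /subnKC <-; elim: (j - i)%N => [|k IHk]; first by rewrite addn0.
by rewrite addnS; exact: le_trans (gamS _) IHk.
Qed.

Let gam0_le1 : gam 0%N <= 1.
Proof. exact: gam_le_beta. Qed.

Let abel_diff (r : nat -> R) N : (forall k, `|r k| <= K) ->
  - (2 * K) <= \sum_(k < N) gam k * (r k - r k.+1).
Proof.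
move=> rK; have K2 : 0 <= 2 * K by rewrite mulr_ge0.
apply: (@abel_lower R gam (fun k => r k - r k.+1) (2 * K) gam_ge0 gamS gam0_le1 K2) => n.
rewrite sum_sub_succ.
by have := rK 0%N; have := rK n; rewrite !ler_norml => /andP[? ?] /andP[? ?]; lra.
Qed.

Let L := 2 * (1 + C + 2 * K * C) / eps.

Let L_ge0 : 0 <= L.
Proof.
have KC : 0 <= K * C by exact: mulr_ge0.
have C0 := C_ge0.
by apply: divr_ge0; [lra|exact: ltW].
Qed.

(** The decrement of [beta] at step [k] is exactly [lam * gam k * (A k + B k)]. *)
Let sum_gam_AB N : lam * \sum_(k < N) gam k * (A k + B k) <= 1.
Proof.
suff -> : lam * \sum_(k < N) gam k * (A k + B k) = 1 - beta N by rewrite gerBl.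
rewrite -(sum_sub_succ beta) mulr_sumr; apply: eq_bigr => k _ /=.
rewrite -/(gam k) -[X in X - _](divfK (lt0r_neq0 (B1_gt0 k))) -/(gam k); ring.
Qed.

(** [growth] bounds the partial sums of A + B + C e - eps below by -C, and [abel_lower] carries this
    to the weighted sums. The A + B part is bounded by [sum_gam_AB]; the e part telescopes up to C
    lam M times the total mass, half of which is absorbed thanks to [lam_small]. *)
Let sum_gam_le N : lam * \sum_(k < N) gam k <= L.
Proof.
set G := \sum_(k < N) gam k.
have C0 := C_ge0; have small := lam_small.
have G0 : 0 <= G by exact: sumr_ge0.
have habel0 := @abel_lower R gam (fun k => A k + B k + C * e k - eps) C gam_ge0 gamS gam0_le1 C_ge0.
have split_sum : \sum_(k < N) gam k * (A k + B k + C * e k - eps) =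
    \sum_(k < N) gam k * (A k + B k) + C * \sum_(k < N) gam k * e k - eps * G.
  rewrite !mulr_sumr -!big_split -sumrB /=; apply: eq_bigr => k _; ring.
have habel : - C <= \sum_(k < N) gam k * (A k + B k + C * e k - eps).
  apply: habel0 => n; rewrite sumrB big_split /= -mulr_sumr sumr_const card_ord -mulr_natr.
  by have := growth n; lra.
rewrite split_sum in habel.
have := sum_gam_AB N; set SAB := \sum_(k < N) gam k * (A k + B k) in habel *; move=> hAB.
set Se := \sum_(k < N) gam k * e k in habel *.
have hSe : Se <= 2 * K + lam * M * G.
  have pK k : `|- p k| <= K by rewrite normrN.
  have hp := abel_diff N pK.
  apply: (@le_trans _ _ (\sum_(k < N) (lam * M * gam k - gam k * (- p k - - p k.+1)))).
    apply: ler_sum => k _; have := ler_wpM2l (gam_ge0 k) (e_le k); lra.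
  rewrite sumrB -mulr_sumr -/G; lra.
have h1 : C * Se <= C * (2 * K + lam * M * G) by exact: ler_wpM2l.
have h2 : C * (lam * M) * (lam * G) <= eps / 2 * (lam * G).
  by apply: ler_wpM2r => //; rewrite mulr_ge0// ltW.
have h3 : lam * (eps * G) <= lam * (C + SAB + C * Se).
  by apply: ler_wpM2l; [exact: ltW|lra].
have h4 : lam * (C * Se) <= lam * (C * (2 * K + lam * M * G)) by apply: ler_wpM2l => //; exact: ltW.
have h5 : lam * (C + 2 * K * C) <= C + 2 * K * C.
  by apply: ler_piMl => //; rewrite addr_ge0// !mulr_ge0.
rewrite /L ler_pdivlMr//; lra.
Qed.

Let delta_lower N : beta N * delta N + lam * \sum_(k < N) gam k * h k <= delta 0%N.
Proof.
elim: N => [|N IHN]; first by rewrite big_ord0 /=; lra.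
rewrite big_ord_recr /=; apply: le_trans IHN.
have := ler_wpM2l (gam_ge0 N) (delta_ge N).
have -> : gam N * ((1 + lam * B N) * delta N) = beta N * delta N.
  by rewrite mulrA /gam divfK// lt0r_neq0.
rewrite -/(gam N); lra.
Qed.

(** Let N grow in [delta_lower]. The boundary term vanishes, the differences of [q] cost 2 K lam /
    mu by summation by parts, and [rho] is multiplied by the total mass, at most [L]. *)
Lemma discounted_lower :
  - (2 * K * lam / mu) - rho * (2 * (1 + C + 2 * K * C) / eps) <= delta 0%N.
Proof.
rewrite -/L; apply/ler_addgt0Pr => x x0.
have [N hN] : exists N : nat, K * L / (lam * x) < N%:R.
  by exists (Num.truncn (K * L / (lam * x))).+1; exact: truncnS_gt.
have N0 : (0 < N)%N.
  rewrite -(ltr_nat R); apply: le_lt_trans hN.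
  by rewrite divr_ge0// mulr_ge0// ltW.
case: N N0 hN => // N _ hN.
(* The weights decrease, so N + 1 times the last one is at most their sum: [beta] decays like 1 / N,
   and the choice of N makes the boundary term at most [x]. *)
have hb : lam * (N.+1%:R * beta N.+1) <= L.
  apply: le_trans (sum_gam_le N.+1); apply: ler_wpM2l; first exact: ltW.
  apply: (@le_trans _ _ (N.+1%:R * gam N)); first by apply: ler_wpM2l => //; exact: beta_le_gam.
  rewrite mulr_natl -[X in _ *+ X]card_ord -sumr_const; apply: ler_sum => k _.
  by apply: gam_le; rewrite -ltnS.
have hbx : beta N.+1 * K <= x.
  rewrite ltr_pdivrMr ?mulr_gt0// in hN.
  have lN : 0 < lam * N.+1%:R by rewrite mulr_gt0.
  rewrite -(ler_pM2l lN); have := ler_wpM2r K_ge0 hb; lra.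
have hd : - (beta N.+1 * K) <= beta N.+1 * delta N.+1.
  rewrite -mulrN; apply: ler_wpM2l => //.
  by have := delta_le N.+1; rewrite ler_norml => /andP[].
have hh : - (2 * K) / mu - rho * \sum_(k < N.+1) gam k <= \sum_(k < N.+1) gam k * h k.
  apply: (@le_trans _ _ (\sum_(k < N.+1) (gam k * (q k - q k.+1) / mu - rho * gam k))).
    rewrite sumrB -mulr_sumr -mulr_suml lerD2r.
    by rewrite ler_pM2r ?invr_gt0//; exact: abel_diff.
  by apply: ler_sum => k _; have := ler_wpM2l (gam_ge0 k) (h_ge k); lra.
have hlh := ler_wpM2l (ltW lam_gt0) hh.
have hr := ler_wpM2l rho_ge0 (sum_gam_le N.+1).
have := delta_lower N.+1.
have -> : 2 * K * lam / mu = lam * (2 * K / mu) by ring.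
lra.
Qed.

End discounted_sums.

(** * Uniformity on compact sets and the mean value theorem *)

Lemma continuous_pair {S T U : topologicalType} (f : S -> T) (g : S -> U) :
  continuous f -> continuous g -> continuous (fun s => (f s, g s)).
Proof. by move=> cf cg s; apply: cvg_pair; [exact: cf|exact: cg]. Qed.

Lemma uniform_near_compact {R : realType} (S T : topologicalType)
    (F : S * T -> R) (A : set S) (t0 : T) (eta : R) :
  compact A -> continuous F -> 0 < eta ->
  \forall t \near t0, forall s, A s -> `|F (s, t) - F (s, t0)| <= eta.
Proof.
move=> /compact_near_coveringP covA cF eta0.
apply: (covA _ _ (fun t s => `|F (s, t) - F (s, t0)| <= eta)) => s0 _.
have eta2 : 0 < eta / 2 by rewrite divr_gt0.
have /cvgrPdist_lt/(_ _ eta2) [[U V] /= [U0 V0] UV] := cF (s0, t0).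
exists (U, V) => // -[s t] [/= Us Vt].
have := UV (s, t) (conj Us Vt); have := UV (s, t0) (conj Us (nbhs_singleton V0)).
rewrite /= => h1 h2.
rewrite (_ : F (s, t) - F (s, t0) = (F (s0, t0) - F (s, t0)) - (F (s0, t0) - F (s, t))); last by ring.
apply: le_trans (ler_normB _ _) _; apply/ltW; lra.
Qed.

Lemma mean_value {R : realType} (f : R -> R) (a b : R) :
  (forall x, derivable f x 1) ->
  exists2 c, `|c - a| <= `|b - a| & f b - f a = derive1 f c * (b - a).
Proof.
move=> df.
have cf A : {within A, continuous f}.
  apply: continuous_subspaceT => x; apply: differentiable_continuous.
  exact/derivable1_diffP.
have isd (x : R) : is_derive x (1 : R) f (derive1 f x) by rewrite derive1E; exact: derivableP.
have [ab|ba|->] := ltgtP a b.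
- have [c cab e] := @MVT R f _ a b ab (fun x _ => isd x) (cf _).
  exists c => //; move: cab; rewrite in_itv /= => /andP[? ?].
  by rewrite !ger0_norm; lra.
- have [c cab e] := @MVT R f _ b a ba (fun x _ => isd x) (cf _).
  exists c; last by rewrite -opprB e; ring.
  move: cab; rewrite in_itv /= => /andP[? ?].
  by rewrite !ler0_norm; lra.
- by exists b; rewrite ?subrr ?mulr0.
Qed.

(** * Monotonicity and linearization of the cost *)

Section vanishing_discount.
Context {R : realType} (X : pmetricType R).
Hypothesis X_compact : compact [set: X].
Variable l : X -> X -> R -> R -> R.
Hypotheses (l_cont : continuous (uncurry4 l)) (l_C1 : C1_in_uv l).
Variables kappa_u kappa_v : R.
Hypotheses (kappa_u_gt0 : 0 < kappa_u) (kappa_v_gt0 : 0 < kappa_v).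
Hypothesis l_u : forall x y u v, - kappa_u <= partial_u l x y u v <= 0.
Hypothesis l_v : forall x y u v, - kappa_v <= partial_v l x y u v <= 0.

Lemma mean_value_u x y a a' b : exists2 c, `|c - a| <= `|a' - a| &
  l x y a' b - l x y a b = partial_u l x y c b * (a' - a).
Proof. by have [d _ _ _] := l_C1; exact: (@mean_value R (l x y ^~ b)). Qed.

Lemma mean_value_v x y a b b' : exists2 c, `|c - b| <= `|b' - b| &
  l x y a b' - l x y a b = partial_v l x y a c * (b' - b).
Proof. by have [_ d _ _] := l_C1; exact: (@mean_value R (l x y a)). Qed.

Lemma l_step_u x y a a' b : a <= a' ->
  - (kappa_u * (a' - a)) <= l x y a' b - l x y a b <= 0.
Proof.
move=> aa; have [c _ ->] := mean_value_u x y a a' b.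
have /andP[c1 c2] := l_u x y c b; have d0 : 0 <= a' - a by rewrite subr_ge0.
by rewrite -mulNr ler_wpM2r//= mulr_le0_ge0.
Qed.

Lemma l_step_v x y a b b' : b <= b' ->
  - (kappa_v * (b' - b)) <= l x y a b' - l x y a b <= 0.
Proof.
move=> bb; have [c _ ->] := mean_value_v x y a b b'.
have /andP[c1 c2] := l_v x y a c; have d0 : 0 <= b' - b by rewrite subr_ge0.
by rewrite -mulNr ler_wpM2r//= mulr_le0_ge0.
Qed.

Lemma l_antitone x y a a' b b' : a <= a' -> b <= b' -> l x y a' b' <= l x y a b.
Proof.
move=> aa bb; have /andP[_ h1] := l_step_u x y b aa; have /andP[_ h2] := l_step_v x y a' bb.
by move: h1 h2; rewrite !subr_le0 => h1 h2; exact: le_trans h1.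
Qed.

Lemma l_lipschitz x y a b :
  `|l x y a b - at_zero l x y| <= kappa_u * `|a| + kappa_v * `|b|.
Proof.
rewrite /at_zero (_ : _ - _ = (l x y a b - l x y 0 b) + (l x y 0 b - l x y 0 0)); last by ring.
apply: le_trans (ler_normD _ _) (lerD _ _).
  have [c _ ->] := mean_value_u x y 0 a b.
  rewrite subr0 normrM ler_wpM2r// ler_norml.
  by have /andP[] := l_u x y c b; have := kappa_u_gt0; move=> *; apply/andP; split; lra.
have [c _ ->] := mean_value_v x y 0 0 b.
rewrite subr0 normrM ler_wpM2r// ler_norml.
by have /andP[] := l_v x y 0 c; have := kappa_v_gt0; move=> *; apply/andP; split; lra.
Qed.

Lemma near_zero_uniform (F : X -> X -> R -> R -> R) (eta : R) :
  continuous (uncurry4 F) -> 0 < eta ->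
  exists2 r, 0 < r & forall x y a b, `|a| <= r -> `|b| <= r ->
    `|F x y a b - F x y 0 0| <= eta.
Proof.
move=> cF eta0.
pose H (p : (X * X) * (R * R)) := uncurry4 F (p.1.1, p.1.2, p.2.1, p.2.2).
have cH : continuous H.
  move=> p; apply: continuous_comp; last exact: cF.
  apply: continuous_pair; first apply: continuous_pair; first apply: continuous_pair.
  - by move=> q; apply: continuous_comp; exact: continuous_fst.
  - by move=> q; apply: continuous_comp; [exact: continuous_fst|exact: continuous_snd].
  - by move=> q; apply: continuous_comp; [exact: continuous_snd|exact: continuous_fst].
  - by move=> q; apply: continuous_comp; exact: continuous_snd.
have [[U V] /= [U0 V0] UV] := uniform_near_compact (0, 0) (compact_pairs X_compact) cH eta0.
have /nbhs_ballP[r1 /= r10 r1U] := U0; have /nbhs_ballP[r2 /= r20 r2V] := V0.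
exists (Num.min r1 r2 / 2); first by rewrite divr_gt0// lt_min r10.
have h : Num.min r1 r2 / 2 < Num.min r1 r2.
  by rewrite ltr_pdivrMr// ltr_pMr ?ltr1n// lt_min r10.
move=> x y a b ha hb.
have := UV (a, b) _ (x, y) Logic.I; apply; split => /=.
  apply: r1U; rewrite /ball /= sub0r normrN (le_lt_trans ha)// (lt_le_trans h)//.
  by rewrite ge_min lexx.
apply: r2V; rewrite /ball /= sub0r normrN (le_lt_trans hb)// (lt_le_trans h)//.
by rewrite ge_min lexx orbT.
Qed.

(* The derivative at 0 vanishes because the difference quotient is 0 at points
   arbitrarily close to 0. *)
Lemma partial_u_eq0 x y s : s != 0 ->
  (forall t, 0 <= t <= 1 -> l x y (t * s) 0 = l x y 0 0) -> partial_u l x y 0 0 = 0.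
Proof.
move=> s0 cst; apply/eqP; apply: contrapT => /negP neq0.
have [_ _ c_u _] := l_C1.
have eta0 : 0 < `|partial_u l x y 0 0| / 2 by rewrite divr_gt0// normr_gt0.
have [r r0 hr] := near_zero_uniform c_u eta0.
pose t := Num.min 1 (r / `|s|).
have t0 : 0 < t by rewrite lt_min ltr01 divr_gt0// normr_gt0.
have t1 : t <= 1 by rewrite ge_min lexx.
have ts : `|t * s| <= r.
  by rewrite normrM (gtr0_norm t0) -ler_pdivlMr ?normr_gt0// ge_min lexx orbT.
have [c cle e] := mean_value_u x y 0 (t * s) 0.
have := e; rewrite cst ?(ltW t0)// subrr subr0 => /esym/eqP.
rewrite mulf_eq0 mulf_eq0 (negbTE s0) (gt_eqF t0) !orbF => /eqP c0.
have := hr x y c 0; rewrite c0 normr0 sub0r normrN => /(_ _ (ltW r0)) H.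
have : `|partial_u l x y 0 0| <= `|partial_u l x y 0 0| / 2.
  by apply: H; rewrite !subr0 in cle; exact: le_trans ts.
lra.
Qed.

Lemma partial_v_eq0 x y s : s != 0 ->
  (forall t, 0 <= t <= 1 -> l x y 0 (t * s) = l x y 0 0) -> partial_v l x y 0 0 = 0.
Proof.
move=> s0 cst; apply/eqP; apply: contrapT => /negP neq0.
have [_ _ _ c_v] := l_C1.
have eta0 : 0 < `|partial_v l x y 0 0| / 2 by rewrite divr_gt0// normr_gt0.
have [r r0 hr] := near_zero_uniform c_v eta0.
pose t := Num.min 1 (r / `|s|).
have t0 : 0 < t by rewrite lt_min ltr01 divr_gt0// normr_gt0.
have t1 : t <= 1 by rewrite ge_min lexx.
have ts : `|t * s| <= r.
  by rewrite normrM (gtr0_norm t0) -ler_pdivlMr ?normr_gt0// ge_min lexx orbT.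
have [c cle e] := mean_value_v x y 0 0 (t * s).
have := e; rewrite cst ?(ltW t0)// subrr subr0 => /esym/eqP.
rewrite mulf_eq0 mulf_eq0 (negbTE s0) (gt_eqF t0) !orbF => /eqP c0.
have := hr x y 0 c; rewrite c0 normr0 sub0r normrN => /(_ (ltW r0)) H.
have : `|partial_v l x y 0 0| <= `|partial_v l x y 0 0| / 2.
  by apply: H; rewrite !subr0 in cle; exact: le_trans ts.
lra.
Qed.

(** The function g of the overview: minus the derivative at 0 of t -> l(x,y,t,t). *)
Definition slope (p : X * X) : R := - (partial_u l p.1 p.2 0 0 + partial_v l p.1 p.2 0 0).

(** By monotonicity [l x y] lies between its values at (0,0) and (a,b) on the rectangle they span.
    Equal values make it constant there, in particular along both axes from the origin. *)
Lemma slope_eq0 x y (a b : R) : (a < 0 /\ b < 0) \/ (0 < a /\ 0 < b) ->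
  l x y a b = at_zero l x y -> slope (x, y) = 0.
Proof.
move=> ab lab; rewrite /at_zero in lab; rewrite /slope /=.
have between (t s : R) : 0 <= t <= 1 -> s < 0 -> s <= t * s /\ t * s <= 0 by split; nra.
have between' (t s : R) : 0 <= t <= 1 -> 0 < s -> 0 <= t * s /\ t * s <= s by split; nra.
rewrite (@partial_u_eq0 x y a) ?(@partial_v_eq0 x y b) ?addr0 ?oppr0//.
- by case: ab => -[_ ?]; [rewrite lt_eqF|rewrite gt_eqF].
- move=> t t01; apply/eqP; rewrite eq_le; case: ab => -[/ltW a0 b0].
    have [? ?] := between t b t01 b0.
    by apply/andP; split; [rewrite -lab|]; exact: l_antitone.
  have [? ?] := between' t b t01 b0.
  by apply/andP; split; [|rewrite -lab]; exact: l_antitone.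
- by case: ab => -[? _]; [rewrite lt_eqF|rewrite gt_eqF].
- move=> t t01; apply/eqP; rewrite eq_le; case: ab => -[a0 /ltW b0].
    have [? ?] := between t a t01 a0.
    by apply/andP; split; [rewrite -lab|]; exact: l_antitone.
  have [? ?] := between' t a t01 a0.
  by apply/andP; split; [|rewrite -lab]; exact: l_antitone.
Qed.

(** Move the two arguments one at a time. Each mean value derivative is within eta / (2 (K + 1)) of
    its value at 0, uniformly in [x] and [y] by compactness; K + 1 avoids dividing by 0. *)
Lemma linearize (K eta : R) : 0 <= K -> 0 < eta ->
  exists2 r, 0 < r & forall lam x y a b, 0 < lam -> lam <= r -> `|a| <= K -> `|b| <= K ->
    `|l x y (lam * a) (lam * b) - at_zero l x y -
      lam * (partial_u l x y 0 0 * a + partial_v l x y 0 0 * b)| <= lam * eta.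
Proof.
move=> K0 eta0; have [_ _ c_u c_v] := l_C1.
have K1 : 0 < K + 1 by lra.
have eta1 : 0 < eta / (2 * (K + 1)) by rewrite divr_gt0// mulr_gt0.
have [r1 r10 h1] := near_zero_uniform c_u eta1.
have [r2 r20 h2] := near_zero_uniform c_v eta1.
set eta' := eta / (2 * (K + 1)) in h1 h2.
have etaE : eta = 2 * (K + 1) * eta' by rewrite /eta' mulrC divfK// mulf_neq0// lt0r_neq0.
exists (Num.min r1 r2 / (K + 1)); first by rewrite divr_gt0// lt_min r10.
move=> lam x y a b lam0; rewrite ler_pdivlMr// le_min => /andP[lr1 lr2] aK bK.
have small c : `|c| <= K -> `|lam * c| <= lam * (K + 1).
  by move=> cK; rewrite normrM (gtr0_norm lam0) ler_pM2l//; lra.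
have [c cle ec] := mean_value_u x y 0 (lam * a) (lam * b).
have [d dle ed] := mean_value_v x y 0 0 (lam * b).
rewrite !subr0 in cle dle ec ed.
have hc : `|partial_u l x y c (lam * b) - partial_u l x y 0 0| <= eta'.
  by apply: h1; [apply: le_trans cle _; exact: le_trans (small _ aK) _
                |exact: le_trans (small _ bK) _].
have hd : `|partial_v l x y 0 d - partial_v l x y 0 0| <= eta'.
  by apply: h2; [rewrite normr0 ltW|apply: le_trans dle _; exact: le_trans (small _ bK) _].
rewrite /at_zero (_ : _ - _ - _ = lam * ((partial_u l x y c (lam * b) - partial_u l x y 0 0) * a +
    (partial_v l x y 0 d - partial_v l x y 0 0) * b)); last first.
  have -> : l x y (lam * a) (lam * b) = partial_u l x y c (lam * b) * (lam * a) +
      partial_v l x y 0 d * (lam * b) + l x y 0 0 by rewrite -ec -ed; ring.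
  ring.
rewrite normrM (gtr0_norm lam0) ler_pM2l//.
apply: le_trans (ler_normD _ _) _; rewrite !normrM.
have m1 := ler_pM (normr_ge0 _) (normr_ge0 _) hc aK.
have m2 := ler_pM (normr_ge0 _) (normr_ge0 _) hd bK.
rewrite etaE; have : 0 < eta' by []. lra.
Qed.

Lemma equicontinuity_modulus (K eta : R) (x0 : X) : 0 < eta ->
  \forall x \near x0, forall z a b, `|a| <= K -> `|b| <= K ->
    `|l z x a b - l z x0 a b| <= eta.
Proof.
move=> eta0.
pose H (p : (X * R * R) * X) := uncurry4 l (p.1.1.1, p.2, p.1.1.2, p.1.2).
have cH : continuous H.
  move=> p; apply: continuous_comp; last exact: l_cont.
  have c1 : continuous (fun q : (X * R * R) * X => q.1) by exact: continuous_fst.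
  have c2 : continuous (fun q : (X * R * R) * X => q.1.1).
    by move=> q; apply: continuous_comp; exact: continuous_fst.
  apply: continuous_pair; first apply: continuous_pair; first apply: continuous_pair.
  - by move=> q; apply: (@continuous_comp _ _ _ (fun q : (X * R * R) * X => q.1.1) fst);
      [exact: c2|exact: continuous_fst].
  - exact: continuous_snd.
  - by move=> q; apply: (@continuous_comp _ _ _ (fun q : (X * R * R) * X => q.1.1) snd);
      [exact: c2|exact: continuous_snd].
  - by move=> q; apply: continuous_comp; [exact: continuous_fst|exact: continuous_snd].
have cA : compact ([set: X] `*` [set` `[- K, K]] `*` [set` `[- K, K]]).
  by do 2 ?apply: compact_setX => //; exact: segment_compact.
apply: filterS (uniform_near_compact x0 cA cH eta0) => x hx z a b aK bK.
by apply: (hx (z, a, b)); split=> //=; [split=> //=|]; rewrite in_itv /= -ler_norml.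
Qed.

(** * Fixed points compared with a weak KAM solution *)

Variables (c0 : R) (u0 : X -> R) (K0 : R).
Hypotheses (u0_cont : continuous u0) (u0_le : forall x, `|u0 x| <= K0).
Hypothesis u0_min : forall x,
  is_min (range (fun y => u0 y + at_zero l y x)) (u0 x - c0).

(** The function e of the overview. Against a closed measure the [u0] terms cancel, so its integral
    vanishes exactly for Mather measures. *)
Definition peierls_defect (p : X * X) : R := at_zero l p.1 p.2 + c0 + u0 p.1 - u0 p.2.

Lemma peierls_defect_ge0 p : 0 <= peierls_defect p.
Proof.
rewrite /peierls_defect; have [_ lb] := u0_min p.2.
have : u0 p.2 - c0 <= u0 p.1 + at_zero l p.1 p.2 by apply: lb; exists p.1.
lra.
Qed.

Lemma slope_ge0 p : 0 <= slope p.
Proof.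
rewrite /slope; have /andP[_ h1] := l_u p.1 p.2 0 0; have /andP[_ h2] := l_v p.1 p.2 0 0.
lra.
Qed.

Lemma continuous_at_zero (F : X -> X -> R -> R -> R) :
  continuous (uncurry4 F) -> continuous (fun p : X * X => F p.1 p.2 0 0).
Proof.
move=> cF p; apply: (@continuous_comp _ _ _
  (fun p : X * X => (p.1, p.2, 0, 0) : X * X * R * R) (uncurry4 F)); last exact: cF.
apply: continuous_pair; last by move=> ?; exact: cvg_cst.
apply: continuous_pair; last by move=> ?; exact: cvg_cst.
by apply: continuous_pair; [exact: continuous_fst|exact: continuous_snd].
Qed.

Lemma slope_continuous : continuous slope.
Proof.
have [_ _ c_u c_v] := l_C1 => p.
by apply: cvgN; apply: cvgD; [exact: (continuous_at_zero c_u)|exact: (continuous_at_zero c_v)].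
Qed.

Lemma peierls_defect_continuous : continuous peierls_defect.
Proof.
move=> p; apply: cvgB; first apply: cvgD; first apply: cvgD.
- exact: (continuous_at_zero l_cont).
- exact: cvg_cst.
- by apply: continuous_comp; [exact: continuous_fst|exact: u0_cont].
- by apply: continuous_comp; [exact: continuous_snd|exact: u0_cont].
Qed.

Variables eps C : R.
Hypotheses (eps_gt0 : 0 < eps) (C_ge0 : 0 <= C).
Hypothesis growth : forall y N,
  eps * N%:R - C <= orbit_sum slope N y + C * orbit_sum peierls_defect N y.

(** Iterating the choice of predecessors gives an infinite orbit with both sums zero, which
    contradicts [growth] as soon as eps N > C. *)
Lemma no_null_orbit (Z : set X) : Z !=set0 ->
  ~ (forall y, Z y -> exists z, [/\ Z z, peierls_defect (z, y) = 0 & slope (z, y) = 0]).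
Proof.
move=> [y0 Zy0] step.
have step' y : exists z, Z y -> [/\ Z z, peierls_defect (z, y) = 0 & slope (z, y) = 0].
  have [Zy|nZy] := pselect (Z y); last by exists y.
  by have [z zP] := step y Zy; exists z.
have [f fP] := choice step'.
pose y k := iter k f y0.
have Zk k : Z (y k) by elim: k => //= k Zk; have [] := fP _ Zk.
pose N := (Num.truncn (C / eps)).+1.
have := growth y N; rewrite /orbit_sum !big1 => [|k _|k _]; first last.
- by have [] := fP _ (Zk k).
- by have [] := fP _ (Zk k).
have : C < N%:R * eps by rewrite -ltr_pdivrMr//; exact: truncnS_gt.
lra.
Qed.

Definition discounted_solution (lam : R) (u : X -> R) :=
  continuous u /\ implicit_Lax_Oleinik_eq l c0 lam u u.

(** The condition on [kappa_u] makes a -> a + l(z,x,lam a,b) strictly increasing. *)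
Definition small_discount (lam : R) := [/\ 0 < lam, lam <= 1 & lam * kappa_u < 1].

Lemma solution_le lam u z x : discounted_solution lam u ->
  u x <= u z + l z x (lam * u z) (lam * u x) + c0.
Proof.
move=> [_ eq]; have [_ lb] := eq x; rewrite -lerBlDr; apply: lb; by exists z.
Qed.

Lemma solution_calibrated lam u x : discounted_solution lam u ->
  exists z, u x = u z + l z x (lam * u z) (lam * u x) + c0.
Proof. by move=> [_ eq]; have [[z _ e] _] := eq x; exists z; rewrite e subrK. Qed.

Lemma K0_ge0 : 0 <= K0.
Proof. exact: le_trans (normr_ge0 _) (u0_le point). Qed.

Lemma u0_bounds x : - K0 <= u0 x /\ u0 x <= K0.
Proof. by have := u0_le x; rewrite ler_norml => /andP. Qed.

(* Where u - u0 attains a minimum below - K0 it also does so at a predecessor,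
   and the step costs nothing: this yields a null orbit. *)
Lemma solution_lower lam u : small_discount lam -> discounted_solution lam u ->
  forall x, - K0 <= u x - u0 x.
Proof.
move=> [lam0 lam1 lamk] sol; have [cu _] := sol.
have [y0 _ y0P] : exists2 c, c \in [set: X] & forall t, t \in [set: X] ->
    u c - u0 c <= u t - u0 t.
  apply: (@compact_EVT_min X R (fun x => u x - u0 x)) => //; first by exists point.
  by apply: continuous_subspaceT => x; apply: continuousB; [exact: cu|exact: u0_cont].
have {}y0P t : u y0 - u0 y0 <= u t - u0 t by apply: y0P; rewrite inE.
set m := u y0 - u0 y0 in y0P.
suff mK : - K0 <= m by move=> x; exact: le_trans mK (y0P x).
rewrite leNgt; apply/negP => mK.
apply: (@no_null_orbit [set y | u y - u0 y = m]); first by exists y0.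
move=> y /= wy; have [z e] := solution_calibrated y sol.
have := peierls_defect_ge0 (z, y); rewrite /peierls_defect /= => d0.
have wz := y0P z.
have mz : m + u0 z < 0 by have := u0_bounds z; lra.
have uy : u y < 0 by have := u0_bounds y; lra.
(* Replacing [u z] by the smaller [m + u0 z] changes [l] by at most lam kappa_u (u z - u0 z - m).
   Together with [s2] and [d0] this closes a chain of inequalities from [u y] to itself, so all of
   them are equalities. *)
have /andP[s1 _] : - (kappa_u * (lam * u z - lam * (m + u0 z))) <=
    l z y (lam * u z) (lam * u y) - l z y (lam * (m + u0 z)) (lam * u y) <= 0.
  by apply: l_step_u; rewrite ler_pM2l//; lra.
have s2 : at_zero l z y <= l z y (lam * (m + u0 z)) (lam * u y).
  by apply: l_antitone; rewrite pmulr_rle0// ltW.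
have s3 : 0 <= (1 - lam * kappa_u) * (u z - u0 z - m) by rewrite mulr_ge0//; lra.
have wz0 : (1 - lam * kappa_u) * (u z - u0 z - m) = 0 by lra.
have wzm : u z - u0 z = m.
  by move/eqP: wz0; rewrite mulf_eq0 => /orP[/eqP|/eqP]; lra.
exists z; split=> //=; first by rewrite /peierls_defect /=; lra.
apply: (@slope_eq0 z y (lam * (m + u0 z)) (lam * u y)); last by lra.
by left; rewrite !pmulr_rlt0.
Qed.

(** The mirror image of [solution_lower] at a maximum of u - u0; the predecessor now calibrates [u0]
    instead of [u]. *)
Lemma solution_upper lam u : small_discount lam -> discounted_solution lam u ->
  forall x, u x - u0 x <= K0.
Proof.
move=> [lam0 lam1 lamk] sol; have [cu _] := sol.
have [y0 _ y0P] : exists2 c, c \in [set: X] & forall t, t \in [set: X] ->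
    u t - u0 t <= u c - u0 c.
  apply: (@compact_EVT_max X R (fun x => u x - u0 x)) => //; first by exists point.
  by apply: continuous_subspaceT => x; apply: continuousB; [exact: cu|exact: u0_cont].
have {}y0P t : u t - u0 t <= u y0 - u0 y0 by apply: y0P; rewrite inE.
set m := u y0 - u0 y0 in y0P.
suff mK : m <= K0 by move=> x; exact: le_trans (y0P x) mK.
rewrite leNgt; apply/negP => mK.
apply: (@no_null_orbit [set y | u y - u0 y = m]); first by exists y0.
move=> y /= wy; have [[z _ e] _] := u0_min y.
have := solution_le z y sol => le_uy.
have wz := y0P z.
have mz : 0 < m + u0 z by have := u0_bounds z; lra.
have uy : 0 < u y by have := u0_bounds y; lra.
have /andP[s1 _] : - (kappa_u * (lam * (m + u0 z) - lam * u z)) <=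
    l z y (lam * (m + u0 z)) (lam * u y) - l z y (lam * u z) (lam * u y) <= 0.
  by apply: l_step_u; rewrite ler_pM2l//; lra.
have s2 : l z y (lam * (m + u0 z)) (lam * u y) <= at_zero l z y.
  by apply: l_antitone; rewrite pmulr_rge0// ltW.
have s3 : 0 <= (1 - lam * kappa_u) * (m - (u z - u0 z)) by rewrite mulr_ge0//; lra.
have wz0 : (1 - lam * kappa_u) * (m - (u z - u0 z)) = 0 by lra.
have wzm : u z - u0 z = m.
  by move/eqP: wz0; rewrite mulf_eq0 => /orP[/eqP|/eqP]; lra.
exists z; split=> //=; first by rewrite /peierls_defect /=; lra.
apply: (@slope_eq0 z y (lam * (m + u0 z)) (lam * u y)); last by lra.
by right; rewrite !pmulr_rgt0.
Qed.

Lemma solution_bounded lam u x : small_discount lam -> discounted_solution lam u ->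
  `|u x| <= 2 * K0.
Proof.
move=> slam sol; have := solution_lower slam sol x; have := solution_upper slam sol x.
by have := u0_bounds x; rewrite ler_norml => *; apply/andP; split; lra.
Qed.

(** Take the calibrating predecessor of the point where [u] is smaller and test it at the other
    point. The implicit argument only helps, as [l] is antitone in it; what remains is the modulus
    of [l] in its second variable. *)
Lemma solution_equicontinuous x0 eta : 0 < eta ->
  \forall x \near x0, forall lam u, small_discount lam -> discounted_solution lam u ->
    `|u x - u x0| <= eta.
Proof.
move=> eta0; apply: filterS (equicontinuity_modulus (2 * K0) x0 eta0).
move=> x hx lam u slam sol; have [lam0 lam1 _] := slam.
have bd z : `|lam * u z| <= 2 * K0.
  rewrite normrM (gtr0_norm lam0); apply: le_trans (solution_bounded z slam sol).
  by rewrite ler_piMl.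
rewrite ler_norml; apply/andP; split.
  have [le|/ltW le] := lerP (u x0) (u x); first by lra.
  have [z e] := solution_calibrated x sol; have h1 := solution_le z x0 sol.
  have h2 : l z x0 (lam * u z) (lam * u x0) <= l z x0 (lam * u z) (lam * u x).
    by apply: l_antitone => //; rewrite ler_pM2l.
  have := hx z _ _ (bd z) (bd x); rewrite ler_norml => /andP[? ?]; lra.
have [le|/ltW le] := lerP (u x) (u x0); first by lra.
have [z e] := solution_calibrated x0 sol; have h1 := solution_le z x sol.
have h2 : l z x (lam * u z) (lam * u x) <= l z x (lam * u z) (lam * u x0).
  by apply: l_antitone => //; rewrite ler_pM2l.
have := hx z _ _ (bd z) (bd x0); rewrite ler_norml => /andP[? ?]; lra.
Qed.


(** * Limit points of fixed points and their comparison *)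

Definition limit_solution (w : X -> R) := forall eta Lam, 0 < eta -> 0 < Lam ->
  exists mu v, [/\ small_discount mu, mu < Lam, discounted_solution mu v &
    forall x, `|v x - w x| <= eta].

Let M := (kappa_u + kappa_v) * (2 * K0).

Let M_ge0 : 0 <= M.
Proof. by rewrite mulr_ge0 ?mulr_ge0 ?K0_ge0// addr_ge0// ltW. Qed.

Lemma solution_step_bound lam u z x : small_discount lam -> discounted_solution lam u ->
  `|l z x (lam * u z) (lam * u x) - at_zero l z x| <= lam * M.
Proof.
move=> slam sol; have [lam0 _ _] := slam.
apply: le_trans (l_lipschitz _ _ _ _) _.
rewrite !normrM (gtr0_norm lam0) /M.
have h1 := ler_wpM2l (mulr_ge0 (ltW kappa_u_gt0) (ltW lam0)) (solution_bounded z slam sol).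
have h2 := ler_wpM2l (mulr_ge0 (ltW kappa_v_gt0) (ltW lam0)) (solution_bounded x slam sol).
lra.
Qed.

Lemma limit_bounded w x : limit_solution w -> `|w x| <= 2 * K0.
Proof.
move=> lw; apply/ler_addgt0Pr => t t0.
have [mu [v [smu _ sol vw]]] := lw t 1 t0 ltr01.
have := vw x; have := solution_bounded x smu sol.
by rewrite !ler_norml => /andP[? ?] /andP[? ?]; apply/andP; split; lra.
Qed.

Lemma limit_subsolution w z x : limit_solution w ->
  w x <= w z + at_zero l z x + c0.
Proof.
move=> lw; apply/ler_addgt0Pr => t t0.
have M1 : 0 < M + 1 by have := M_ge0; lra.
have t3 : 0 < t / 3 by rewrite divr_gt0.
have [mu [v [smu muL sol vw]]] := lw (t / 3) (t / 3 / (M + 1)) t3 (divr_gt0 t3 M1).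
have := vw x; have := vw z; have := solution_le z x sol.
have := solution_step_bound z x smu sol.
have [mu0 _ _] := smu.
have : mu * M <= t / 3 by rewrite ltr_pdivlMr// in muL; lra.
by move=> h1; rewrite !ler_norml => /andP[? ?] ? /andP[? ?] /andP[? ?]; lra.
Qed.

Let Lconst := 2 * (1 + C + 2 * (4 * K0) * C) / eps.

Let Lconst_ge0 : 0 <= Lconst.
Proof.
have h := mulr_ge0 K0_ge0 C_ge0; have C0 := C_ge0.
by apply: divr_ge0; [lra|exact: ltW].
Qed.

(* Discounted summation along a backward orbit of u: the linearization of v at
   the fixed small discount mu bounds the weighted first-order defects of w from
   below, up to a telescoping term of size lam / mu. *)
Lemma comparison (w : X -> R) (delta : R) : limit_solution w -> 0 < delta ->
  exists2 Lam, 0 < Lam & forall lam u, small_discount lam -> lam < Lam ->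
    discounted_solution lam u -> forall x, w x - delta <= u x.
Proof.
move=> lw delta0.
have M0 := M_ge0; have L0 := Lconst_ge0; have K00 := K0_ge0; have C0 := C_ge0.
pose kap := kappa_u + kappa_v.
have kap0 : 0 < kap by rewrite addr_gt0.
have D0 : 0 < 2 * (2 + kap) * (Lconst + 1) by rewrite !mulr_gt0//; lra.
(* So chosen that the linearization errors, eta (2 + kap) times the total mass [Lconst], stay below
   delta / 2. *)
pose eta := delta / (2 * (2 + kap) * (Lconst + 1)).
have eta0 : 0 < eta by rewrite divr_gt0.
have etaE : 2 * (2 + kap) * (Lconst + 1) * eta = delta.
  by rewrite mulrC divfK// lt0r_neq0.
have K20 : 0 <= 2 * K0 by rewrite mulr_ge0.
have [r r0 lin] := linearize K20 eta0.
have [mu [v [smu mur solv vw]]] := lw eta r eta0 r0.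
have [mu0 mu1 muk] := smu.
have E0 : 0 < 2 * (2 * (4 * K0) + M * Lconst + 1).
  by have : 0 <= M * Lconst by [exact: mulr_ge0|]; lra.
have F0 : 0 < 2 * (C * M + 1) by have : 0 <= C * M by [exact: mulr_ge0|]; lra.
(* The three bounds serve the linearization of [u], the terms of size lam / mu (at most delta / 2
   since [mu] is already fixed), and the hypothesis [lam_small]. *)
exists (Num.min r (Num.min (mu * delta / (2 * (2 * (4 * K0) + M * Lconst + 1)))
    (eps / (2 * (C * M + 1))))).
  by rewrite !lt_min r0 !divr_gt0// mulr_gt0.
move=> lam u slam; rewrite !lt_min => /and3P[lamr lam2 lam3] solu x.
rewrite ltr_pdivlMr// in lam2; rewrite ltr_pdivlMr// in lam3.
have [lam0 lam1 lamk] := slam.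
have [f fP] := choice (fun x => solution_calibrated x solu).
pose y k := iter k f x.
pose A k := - partial_u l (y k.+1) (y k) 0 0.
pose B k := - partial_v l (y k.+1) (y k) 0 0.
pose L0k k := at_zero l (y k.+1) (y k).
have A_bd k : 0 <= A k /\ A k <= kappa_u.
  by have /andP[] := l_u (y k.+1) (y k) 0 0; rewrite /A => ? ?; split; lra.
have B_bd k : 0 <= B k /\ B k <= kappa_v.
  by have /andP[] := l_v (y k.+1) (y k) 0 0; rewrite /B => ? ?; split; lra.
have orbit k : u (y k) = u (y k.+1) + l (y k.+1) (y k) (lam * u (y k.+1)) (lam * u (y k)) + c0.
  exact: fP.
have step k : `|l (y k.+1) (y k) (lam * u (y k.+1)) (lam * u (y k)) - L0k k| <= lam * M.
  exact: solution_step_bound.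
have ub z := solution_bounded z slam solu.
have vb z := solution_bounded z smu solv.
have wb z := limit_bounded z lw.
have linu k : - (lam * eta) <= l (y k.+1) (y k) (lam * u (y k.+1)) (lam * u (y k)) - L0k k
    + lam * (A k * u (y k.+1) + B k * u (y k)).
  have := lin lam (y k.+1) (y k) _ _ lam0 (ltW lamr) (ub (y k.+1)) (ub (y k)).
  by rewrite ler_norml /A /B /L0k => /andP[? _]; lra.
have linv k : l (y k.+1) (y k) (mu * v (y k.+1)) (mu * v (y k)) - L0k k
    + mu * (A k * v (y k.+1) + B k * v (y k)) <= mu * eta.
  have := lin mu (y k.+1) (y k) _ _ mu0 (ltW mur) (vb (y k.+1)) (vb (y k)).
  by rewrite ler_norml /A /B /L0k => /andP[_ ?]; lra.
(* All functions are bounded by 2 K0, so 4 K0 bounds their differences. In [rho], lam M / mu is the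
   cost of one step of [u] and eta (2 + kap) collects the linearization of [v], the eta inside h,
   and the distance from [v] to [w]. *)
have := @discounted_lower R lam mu C eps (4 * K0) M (lam * M / mu + eta * (2 + kap)) A B
  (fun k => peierls_defect (y k.+1, y k)) (fun k => u (y k) - u0 (y k))
  (fun k => v (y k) - u (y k))
  (fun k => - (A k * w (y k.+1) + B k * w (y k)) - eta)
  (fun k => u (y k) - w (y k)) lam0 lam1 mu0 eps_gt0 C_ge0.
rewrite -/Lconst => main.
suff : - (2 * (4 * K0) * lam / mu) - (lam * M / mu + eta * (2 + kap)) * Lconst <= u x - w x.
  have h1 : 2 * (4 * K0) * lam / mu + lam * M / mu * Lconst <= delta / 2.
    rewrite (_ : _ + _ = lam * (2 * (4 * K0) + M * Lconst) / mu); last by ring.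
    rewrite ler_pdivrMr//; have : 0 <= lam by exact: ltW.
    lra.
  have h2 : eta * (2 + kap) * Lconst <= delta / 2.
    by have : 0 <= (2 + kap) * eta by [rewrite mulr_ge0 ?ltW//; lra|]; lra.
  lra.
apply: main.
- by rewrite mulr_ge0.
- apply: addr_ge0; first by rewrite divr_ge0 ?mulr_ge0// ltW.
  by rewrite mulr_ge0 ?ltW//; lra.
- by move=> k; have [] := A_bd k.
- by move=> k; have [] := B_bd k.
- move=> k; have [_ hA] := A_bd k; have := ler_wpM2l (ltW lam0) hA; lra.
- move=> N; apply: le_trans (growth y N) _; rewrite lerD2r /orbit_sum.
  by apply: ler_sum => k _; rewrite /slope /A /B /=; lra.
- move=> k; have := step k; rewrite ler_norml /L0k => /andP[? ?].
  by have := orbit k; rewrite /peierls_defect /=; lra.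
- move=> k; have := linu k; have := orbit k; have := limit_subsolution (y k.+1) (y k) lw.
  by rewrite /L0k; lra.
- move=> k.
  (* Subtract the calibration of [u] from the inequality for [v] on the same step; the linearized
     [v] leaves a term of order mu, to be divided by mu. *)
  have h1 : v (y k) - u (y k) - (v (y k.+1) - u (y k.+1)) <=
      lam * M + mu * (- (A k * v (y k.+1) + B k * v (y k)) + eta).
    have := linv k; have := orbit k; have := solution_le (y k.+1) (y k) solv.
    by have := step k; rewrite ler_norml => /andP[? ?]; lra.
  have h2 : (v (y k) - u (y k) - (v (y k.+1) - u (y k.+1))) / mu <=
      lam * M / mu - (A k * v (y k.+1) + B k * v (y k)) + eta.
    rewrite ler_pdivrMr//; apply: le_trans h1 _.
    by rewrite [leRHS](_ : _ = lam * M + mu * (- (A k * v (y k.+1) + B k * v (y k)) + eta))//; field; lra.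
  have [A0 Ak] := A_bd k; have [B0 Bk] := B_bd k.
  have vw1 : w (y k.+1) - v (y k.+1) <= eta.
    by have := vw (y k.+1); rewrite ler_norml => /andP[? ?]; lra.
  have vw0 : w (y k) - v (y k) <= eta.
    by have := vw (y k); rewrite ler_norml => /andP[? ?]; lra.
  have h3 := le_trans (ler_wpM2l A0 vw1) (ler_wpM2r (ltW eta0) Ak).
  have h4 := le_trans (ler_wpM2l B0 vw0) (ler_wpM2r (ltW eta0) Bk).
  by rewrite /kap; lra.
- move=> k; have := u0_bounds (y k); have := ub (y k); rewrite !ler_norml => /andP[? ?] ?.
  by apply/andP; split; lra.
- move=> k; have := vb (y k); have := ub (y k); rewrite !ler_norml => /andP[? ?] /andP[? ?].
  by apply/andP; split; lra.
- move=> k; have := wb (y k); have := ub (y k); rewrite !ler_norml => /andP[? ?] /andP[? ?].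
  by apply/andP; split; lra.
- by lra.
Qed.


(** * Compactness and convergence of selections *)

(** Arzela-Ascoli along an ultrafilter: boundedness gives pointwise limits, and equicontinuity with
    compactness makes the convergence uniform. *)
Lemma ultra_limit (I : Type) (U : set_system I) (lam : I -> R) (u : I -> X -> R) :
  UltraFilter U ->
  (\forall i \near U, small_discount (lam i) /\ discounted_solution (lam i) (u i)) ->
  exists w : X -> R, forall eta, 0 < eta -> \forall i \near U, forall x, `|u i x - w x| <= eta.
Proof.
move=> UU sol; have UP : ProperFilter U by exact: ultra_proper.
pose w x := lim ((fun i => u i x) @ U).
have uw x : (fun i => u i x) @ U --> w x.
  apply: (@ultra_cvg R I U UU (fun i => u i x) (2 * K0)).
  by apply: filterS sol => i [? ?]; exact: (@solution_bounded (lam i)).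
have near_w x eta : 0 < eta -> \forall i \near U, `|u i x - w x| <= eta.
  move=> eta0; have /cvgrPdist_le/(_ _ eta0) := uw x.
  by apply: filterS => i; rewrite distrC.
exists w => eta eta0.
have eta4 : 0 < eta / 4 by rewrite divr_gt0.
have eta8 : 0 < eta / 8 by rewrite divr_gt0.
have /compact_near_coveringP cov := X_compact.
have FU : Filter U by exact: filter_filter.
have H := cov I U (fun i x => `|u i x - w x| <= eta) FU.
apply: filterS (H _) => [i hi x|x0 _]; first exact: hi.
have V := solution_equicontinuous x0 eta4.
exists ([set x | forall lam u, small_discount lam -> discounted_solution lam u ->
    `|u x - u x0| <= eta / 4], [set i | (small_discount (lam i) /\
    discounted_solution (lam i) (u i)) /\ `|u i x0 - w x0| <= eta / 4]).
  by split=> //=; apply: filterI => //; exact: near_w.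
move=> [x i] /= [hx [[slam soli] hi]].
have ux := hx _ _ slam soli.
(* An auxiliary index [j] transfers equicontinuity to [w]; the five errors 1/4, 1/4, 1/8, 1/4, 1/8
   add up to one eta. *)
have [j [[[slj solj] hj0] hjx]] : exists j, ((small_discount (lam j) /\
    discounted_solution (lam j) (u j)) /\ `|u j x0 - w x0| <= eta / 8) /\
    `|u j x - w x| <= eta / 8.
  by apply: (@filter_ex _ U); apply: filterI; [apply: filterI|]; [exact: sol|exact: near_w|exact: near_w].
have uj := hx _ _ slj solj.
move: hi ux uj hj0 hjx; rewrite !ler_norml.
by move=> /andP[? ?] /andP[? ?] /andP[? ?] /andP[? ?] /andP[? ?]; apply/andP; split; lra.
Qed.

Variable lam0 : R.
Hypotheses (lam0_gt0 : 0 < lam0) (lam0_small : lam0 * kappa_u < 1).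

Lemma near_small_discount : \forall lam \near 0^'+, small_discount lam /\ lam < lam0.
Proof.
have lam0_gt0' := lam0_gt0.
near=> lam; have lam_gt0 : 0 < lam by near: lam; exact: nbhs_right_gt.
have lam_lt : lam < lam0 by near: lam; exact: nbhs_right_lt.
split=> //; split=> //; first by near: lam; exact: nbhs_right_le.
by apply: lt_trans lam0_small; rewrite ltr_pM2r.
Unshelve. all: by end_near. Qed.

Lemma ultra_limit_solution (U : set_system R) (u : R -> X -> R) (w : X -> R) :
  UltraFilter U -> 0^'+ `<=` U ->
  (forall lam, 0 < lam < lam0 -> discounted_solution lam (u lam)) ->
  (forall eta, 0 < eta -> \forall lam \near U, forall x, `|u lam x - w x| <= eta) ->
  limit_solution w.
Proof.
move=> UU leU sol uw eta Lam eta0 Lam0.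
have UP : ProperFilter U by exact: ultra_proper.
have sU : U [set lam | (small_discount lam /\ lam < lam0) /\ lam < Lam].
  by apply: leU; apply: filterI; [exact: near_small_discount|exact: nbhs_right_lt].
have [lam [[[slam lam_lt] lamL] uwl]] := @filter_ex _ U _ _ (filterI sU (uw eta eta0)).
exists lam, (u lam); split=> //; apply: sol; have [? _ _] := slam.
by apply/andP.
Qed.

Lemma solution_near (u : R -> X -> R) :
  (forall lam, 0 < lam < lam0 -> discounted_solution lam (u lam)) ->
  \forall lam \near 0^'+, small_discount lam /\ discounted_solution lam (u lam).
Proof.
move=> sol; apply: filterS near_small_discount => lam [slam lt]; split=> //.
by apply: sol; have [? _ _] := slam; apply/andP.
Qed.

(** The limit [w] comes from one selection along one ultrafilter. [comparison] bounds every
    selection below by [w]; a failing upper bound would produce a second limit point [w'], which the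
    same comparison places below [w]. *)
Lemma selections_converge : exists w : X -> R, forall u : R -> X -> R,
  (forall lam, 0 < lam < lam0 -> discounted_solution lam (u lam)) ->
  forall eta, 0 < eta -> \forall lam \near 0^'+, forall x, `|u lam x - w x| <= eta.
Proof.
have [[u1 sol1]|none] := pselect (exists u : R -> X -> R,
    forall lam, 0 < lam < lam0 -> discounted_solution lam (u lam)); last first.
  by exists (fun=> 0) => u sol; case: none; exists u.
have [U [UU leU]] := @ultraFilterLemma R 0^'+ _.
have [w u1w] := ultra_limit UU (leU _ (solution_near sol1)).
have lw := ultra_limit_solution UU leU sol1 u1w.
exists w => u sol eta eta0.
have eta3 : 0 < eta / 3 by rewrite divr_gt0.
have [Lam Lam0 lower] := comparison lw eta0.
have near_lower : \forall lam \near 0^'+, forall x, w x - eta <= u lam x.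
  near=> lam; have [slam soll] : small_discount lam /\ discounted_solution lam (u lam).
    by near: lam; exact: solution_near.
  by apply: lower soll => //; near: lam; exact: nbhs_right_lt.
suff near_upper : \forall lam \near 0^'+, forall x, u lam x <= w x + eta.
  apply: filterS2 near_lower near_upper => lam lo up x.
  by have := lo x; have := up x; rewrite ler_norml => *; apply/andP; split; lra.
apply: contrapT => not_near.
(* If the upper bound fails, [bad] meets every neighbourhood filter set at 0+, and an ultrafilter
   through [bad] gives the limit [w']. *)
pose bad := [set lam | ~ forall x, u lam x <= w x + eta].
have badP : ProperFilter (within bad 0^'+).
  split; last exact: within_filter.
  move=> bad0; apply: not_near.
  have {}bad0 : \forall lam \near (0 : R)^'+, bad lam -> False := bad0.
  apply: filterS bad0 => lam hb.
  by apply: contrapT => nb; exact: hb.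
have [V [VU leV]] := @ultraFilterLemma R (within bad 0^'+) badP.
have leV0 : 0^'+ `<=` V.
  by move=> A A0; apply: leV; apply: filterS A0 => lam Al _.
have [w' uw'] := ultra_limit VU (leV0 _ (solution_near sol)).
have lw' := ultra_limit_solution VU leV0 sol uw'.
have [Lam' Lam'0 lower'] := comparison lw' eta3.
(* A fixed point [v] close to [w] with discount below [Lam'] is bounded below by [w'], up to eta /
   3. *)
have [mu [v [smu mul solv vw]]] := lw (eta / 3) Lam' eta3 Lam'0.
have w'w x : w' x <= w x + eta / 3 + eta / 3.
  have := lower' mu v smu mul solv x; have := vw x; rewrite ler_norml => /andP[? ?].
  lra.
have VP : ProperFilter V by exact: ultra_proper.
have Vbad : V bad by apply: leV; exact: withinT.
have [lam [badl closel]] := @filter_ex _ V _ _ (filterI Vbad (uw' _ eta3)).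
apply: badl => x; have := closel x; rewrite ler_norml => /andP[_ ?].
by have := w'w x; lra.
Unshelve. all: by end_near. Qed.


End vanishing_discount.

(** * Fixed points of the operator and conclusion *)

(** If no continuous solution existed, the operator would return the default [u + 1], which is not
    [u]. *)
Lemma fixed_point_solution {R : realType} (X : pmetricType R)
    (l : X -> X -> R -> R -> R) (c0 lam : R) (u : X -> R) :
  Lax_Oleinik_fixed_points l c0 lam u -> discounted_solution l c0 lam u.
Proof.
move=> [_]; rewrite /implicit_Lax_Oleinik; set T := [set psi | _] => fix_u.
have [exT|nexT] := pselect (exists psi, T psi).
  by have := xgetPex (fun x => u x + 1) exT; rewrite fix_u.
move: fix_u; rewrite xgetPN => [/(congr1 (@^~ point))|psi Tpsi]; last by apply: nexT; exists psi.
by move=> /eqP; rewrite addrC -subr_eq0 addrK oner_eq0.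
Qed.

Unset Implicit Arguments.

Theorem theorem2 (R : realType) (X : pmetricType R)
  (X_compact : compact [set: X])
  (l : X -> X -> R -> R -> R)
  (l_cont : continuous (uncurry4 l)) (l_C1 : C1_in_uv l)
  (kappa_u kappa_v : R) (kappa_u_gt0 : 0 < kappa_u) (kappa_v_gt0 : 0 < kappa_v)
  (l_u : forall x y u v, - kappa_u <= partial_u l x y u v <= 0)
  (l_v : forall x y u v, - kappa_v <= partial_v l x y u v <= 0)
  (c0 : R) (c0_critical : critical_constant (at_zero l) c0)
  (l_Mather : forall mu : probability (borel (X * X)%type) R,
     Mather_measure (at_zero l) c0 mu ->
     (\int[mu]_p (partial_u l p.1 p.2 0 0 + partial_v l p.1 p.2 0 0)%:E < 0)%E)
  (lam0 : R) (lam0_gt0 : 0 < lam0)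
  (lam0_small : lam0 * Num.max kappa_u kappa_v < 1) :
  exists u0 : X -> R, forall ulam : R -> X -> R,
    (forall lam, 0 < lam < lam0 -> Lax_Oleinik_fixed_points l c0 lam (ulam lam)) ->
    {uniform, ulam lam @[lam --> 0^'+] --> u0}.
Proof.
have [u0 [u0_cont u0_min]] := c0_critical.
have [K0 _ u0_le] := continuous_bounded X_compact u0_cont.
have cd := peierls_defect_continuous l_cont (c0 := c0) u0_cont.
have cs := slope_continuous l_C1.
have integrable_cont (mu : probability (borel (X * X)%type) R) (g : X * X -> R) :
    continuous g -> mu.-integrable [set: borel (X * X)%type] (EFin \o g).
  exact: (@integrable_continuous R (X * X)%type mu g (compact_pairs X_compact)).
have cu1 : continuous (fun p : X * X => u0 p.1).
  by move=> p; apply: continuous_comp; [exact: continuous_fst|exact: u0_cont].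
have cu2 : continuous (fun p : X * X => u0 p.2).
  by move=> p; apply: continuous_comp; [exact: continuous_snd|exact: u0_cont].
have [eps [C [eps_gt0 C_ge0 growth]]] : exists eps C : R, [/\ 0 < eps, 0 <= C &
    forall y N, eps * N%:R - C <=
      orbit_sum (slope l) N y + C * orbit_sum (peierls_defect l c0 u0) N y].
  apply: orbit_growth => //.
  - by move=> p; exact: peierls_defect_ge0.
  - by move=> p; exact: (slope_ge0 l_u l_v).
  (* Solving the definition of the defect for the cost and integrating, the [u0] terms cancel and
     [mu] is a Mather measure; a zero integral of the slope then contradicts [l_Mather]. *)
  move=> mu mu_closed int_defect int_slope.
  have : Mather_measure (at_zero l) c0 mu.
    split=> //.
    transitivity (\int[mu]_p (((peierls_defect l c0 u0 p)%:E - (u0 p.1)%:E) +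
        ((u0 p.2)%:E - c0%:E)))%E.
      apply: eq_integral => p _; rewrite -!EFinB -EFinD; congr EFin.
      by rewrite /peierls_defect; ring.
    have i0 := integrable_cont mu _ cd; have i1 := integrable_cont mu _ cu1.
    have i2 := integrable_cont mu _ cu2.
    have i3 : mu.-integrable [set: borel (X * X)%type] (cst c0%:E).
      exact: finite_measure_integrable_cst.
    rewrite integralD//; [|exact: integrableB|exact: integrableB].
    rewrite integralB// integralB// int_defect integral_cst//.
    rewrite [X in (_ * X)%E](@probability_setT _ (borel (X * X)%type) R mu) mule1.
    rewrite (closed_measure_integral X_compact mu_closed u0_cont).
    have fin : (\int[mu]_p (u0 p.2)%:E)%E \is a fin_num by exact: integrable_fin_num i2.
    by rewrite -(fineK fin) -!EFinB -EFinD; congr EFin; ring.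
  move=> /l_Mather; rewrite (_ : (\int[mu]_p _)%E = 0%E) ?ltxx//.
  transitivity (\int[mu]_p (- (slope l p)%:E))%E.
    by apply: eq_integral => p _; rewrite /slope -EFinN opprK.
  have := integrable_add_def measurableT (integrable_cont mu _ cs).
  by move=> /(@integralN _ (borel (X * X)%type) R mu) ->; rewrite int_slope oppe0.
have lam0_u : lam0 * kappa_u < 1.
  apply: le_lt_trans lam0_small; rewrite ler_pM2l//.
  by rewrite le_max lexx.
have [w wP] := selections_converge X_compact l_cont l_C1 kappa_u_gt0 kappa_v_gt0 l_u l_v
  u0_cont u0_le u0_min eps_gt0 C_ge0 growth lam0_gt0 lam0_u.
exists w => ulam sol P /uniform_nbhs[E [/= entE EP]].
move: entE; rewrite -entourage_ballE => -[r /= r0 rE].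
have r2 : 0 < r / 2 by rewrite divr_gt0.
have := wP ulam (fun lam h => fixed_point_solution (sol lam h)) _ r2.
apply: filterS => lam close; apply: EP => x _; apply: rE => /=.
rewrite /ball /= distrC; apply: le_lt_trans (close x) _.
by rewrite ltr_pdivrMr// ltr_pMr// ltr1n.
Qed.
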